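(* Let $q$ be a prime power, $k$ an algebraic closure of $\mathbb{F}_{q^2}$, and $A\in\mathrm{GL}_4(k)$. Let $d$ be a positive integer. If $\mathcal{T}_d$ is nonempty, then $$d=q+1,\qquad d=q(q+1)\ \text{ for } q \text{ even},\qquad\text{or}\qquad d=\tfrac{q(q+1)}{2}\ \text{ for } q \text{ odd},$$ and then all curves of $\mathcal{T}_d$ are projectively isomorphic over $k$ to $$C_I(q+1,1,q),\qquad C_I\left(q(q+1),\,q+1,\,q^2+1\right),\qquad\text{or}\qquad C_I\left(\tfrac{q(q+1)}{2},\,\tfrac{q+1}{2},\,\tfrac{q^2+1}{2}\right),$$ respectively, where $I$ is the $4\times 4$ identity matrix. Further, all curves of $\mathcal{T}_{q+1}$ are smooth, but those of $\mathcal{T}_{q(q+1)}$ and of $\mathcal{T}_{\frac{q(q+1)}{2}}$ both have just ${}^t(1,0,0,0)$ and ${}^t(0,0,0,1)$ as singular points, and these curves are all non-reflexive.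
   Context: Points of projective space are written as column vectors and ${}^tM$ denotes the transpose of a matrix $M$. For a matrix $M=(m_{i,j})$ with entries in $k$ put $M^{(q)}=(m_{i,j}^q)$. For $A\in\mathrm{GL}_4(k)$, the smooth $k$-Hermitian surface is $X_A=\{\boldsymbol{x}\in\mathbb{P}^3 : {}^t\boldsymbol{x}A\boldsymbol{x}^{(q)}=0\}$. A rational curve of degree $d$ in $\mathbb{P}^3$ is denoted $C_d$; it is the image of $\mathbb{P}^1$ under ${}^t(s,t)\mapsto F\,{}^t(s^d,s^{d-1}t,\dots,st^{d-1},t^d)$ for a nonzero $4\times(d+1)$ matrix $F$ over $k$. For $F^*\in\mathrm{GL}_4(k)$ and positive integers $d,i,j$ with $1\le i\ne j\le d-1$ and $\gcd(d,i,j)=1$, put $$C_{F^*}(d,i,j)=\{F^*\,{}^t(s^d,s^{d-i}t^i,s^{d-j}t^j,t^d)\in\mathbb{P}^3 : {}^t(s,t)\in\mathbb{P}^1\}.$$ $\mathcal{T}_d$ is the set of rational curves $C_d\subset X_A$ of degree $d$ such that, under a suitable choice of the homogeneous coordinates $s,t$ of $\mathbb{P}^1$, $C_d=C_{F^*}(d,i,j)$ for some $F^*\in\mathrm{GL}_4(k)$ and some such $i,j$. A projective curve is reflexive if its conormal variety coincides (after exchanging $\mathbb{P}^3$ and its dual) with the conormal variety of its dual variety; equivalently, if the projection from the conormal variety to the dual variety is separable. Otherwise it is non-reflexive.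
   Formalization: The case q = 2, d = 4 is excluded, since C_I(4,1,3) makes T_4 nonempty there; for q = 2, 3 only (1,0,0,0) is singular, both points being singular when q > 3; singular points are stated for the models and carried to each curve by the projective isomorphism. *)

(* Defs.v *)
From HB Require Import structures.
From mathcomp Require Import all_boot all_order all_algebra.
From mathcomp Require Import boolp classical_sets.
From mathcomp Require Import mpoly.
Set Implicit Arguments.
Unset Strict Implicit.
Unset Printing Implicit Defensive.
Import GRing.Theory.
Local Open Scope classical_set_scope.
Local Open Scope ring_scope.

(* A subset X of P^(m-1) is encoded by the set of all homogeneous coordinate
   vectors of its points, i.e. by the punctured cone over X: every set of
   vectors built below omits 0 and is stable under nonzero scaling. *)

Section ProjectiveSets.
Variables (k : fieldType) (m : nat).
Implicit Types (X : set 'cV[k]_m) (x v h : 'cV[k]_m).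

Definition proj_point x : set 'cV[k]_m :=
  [set y | y != 0 /\ exists c : k, y = c *: x].

Definition proj_image (M : 'M[k]_m) X : set 'cV[k]_m := [set M *m x | x in X].

Definition proj_isomorphic X Y : Prop :=
  exists2 M : 'M[k]_m, M \in unitmx & X = proj_image M Y.

Definition mevalc (f : {mpoly k[m]}) x : k := f.@[fun i => x i 0].

(* f lies in the vanishing ideal of X.  Over an infinite field this ideal is
   homogeneous, hence f itself need not be assumed homogeneous. *)
Definition vanishes_on X (f : {mpoly k[m]}) : Prop :=
  forall x, X x -> mevalc f x = 0.

Definition alg_indep_on X (n : nat) (f : n.-tuple {mpoly k[m]}) : Prop :=
  forall P : {mpoly k[n]}, vanishes_on X (P \mPo f) -> P = 0.

(* dim X = r, as the transcendence degree r + 1 of the homogeneous coordinate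
   ring, minus one. *)
Definition has_dim X (r : nat) : Prop :=
  (exists f : r.+1.-tuple {mpoly k[m]}, alg_indep_on X f) /\
  ~ (exists f : r.+2.-tuple {mpoly k[m]}, alg_indep_on X f).

(* The linear subspace of k^m whose projectivisation is the embedded projective
   tangent space of X at x. *)
Definition tangent X x : set 'cV[k]_m :=
  [set v | forall f : {mpoly k[m]}, vanishes_on X f ->
     \sum_(i < m) mevalc (f^`M(i)) x * v i 0 = 0].

(* Jacobian criterion, for X of pure dimension. *)
Definition smooth_point X x : Prop :=
  X x /\ exists2 r : nat, has_dim X r &
    exists2 U : {vspace 'cV[k]_m}, tangent X x = [set v | v \in U] &
      \dim U = r.+1.

Definition singular_locus X : set 'cV[k]_m := [set x | X x /\ ~ smooth_point X x].

Definition nonsingular X : Prop := forall x, X x -> smooth_point X x.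

(* The hyperplane h_1 x_1 + ... + h_m x_m = 0 is identified with the point h of
   the dual projective space. *)
Definition tangent_pairs X : set ('cV[k]_m * 'cV[k]_m) :=
  [set xh | [/\ smooth_point X xh.1, xh.2 != 0 &
     forall v, tangent X xh.1 v -> xh.2^T *m v = 0]].

End ProjectiveSets.

Section Reflexivity.
Variables (k : fieldType) (m : nat).
Implicit Types (X : set 'cV[k]_m) (S : set ('cV[k]_m * 'cV[k]_m)).

(* Zariski closure in P^(m-1) x P^(m-1).  As S is stable under scaling each
   factor separately, bihomogeneous equations give the same closure. *)
Definition biclosure S : set ('cV[k]_m * 'cV[k]_m) :=
  [set xh | [/\ xh.1 != 0, xh.2 != 0 &
     forall f : {mpoly k[m + m]},
       (forall yg, S yg -> mevalc f (col_mx yg.1 yg.2) = 0) ->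
       mevalc f (col_mx xh.1 xh.2) = 0]].

Definition conormal X : set ('cV[k]_m * 'cV[k]_m) := biclosure (tangent_pairs X).

Definition dual_variety X : set 'cV[k]_m :=
  [set h | exists x, conormal X (x, h)].

Definition reflexive_variety X : Prop :=
  conormal X = [set xh | conormal (dual_variety X) (xh.2, xh.1)].

End Reflexivity.

Section Curves.
Variable k : fieldType.

Definition hermitian_surface (q : nat) (A : 'M[k]_4) : set 'cV[k]_4 :=
  [set x | x != 0 /\ x^T *m A *m map_mx (fun a => a ^+ q) x = 0].

Definition veronese (d : nat) (s t : k) : 'cV[k]_d.+1 :=
  \col_(l < d.+1) (s ^+ (d - l) * t ^+ l).

Definition param_image (phi : k -> k -> 'cV[k]_4) : set 'cV[k]_4 :=
  [set x | exists s t : k, (s, t) != (0, 0) /\ proj_point (phi s t) x].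

Definition rational_curve (d : nat) (C : set 'cV[k]_4) : Prop :=
  exists2 F : 'M[k]_(4, d.+1), F != 0 &
    C = param_image (fun s t => F *m veronese d s t).

Definition monomials4 (d i j : nat) (s t : k) : 'cV[k]_4 :=
  \col_(l < 4) [:: s ^+ d; s ^+ (d - i) * t ^+ i;
                   s ^+ (d - j) * t ^+ j; t ^+ d]`_l.

Definition monomial_curve (F : 'M[k]_4) (d i j : nat) : set 'cV[k]_4 :=
  param_image (fun s t => F *m monomials4 d i j s t).

Definition admissible (d i j : nat) : Prop :=
  [/\ (0 < i < d)%N, (0 < j < d)%N, i <> j & gcdn d (gcdn i j) = 1%N].

(* The curves are subsets of P^3, so a change of the homogeneous coordinates of
   P^1 does not affect the equality with a monomial curve. *)
Definition curves_T (q : nat) (A : 'M[k]_4) (d : nat) : set (set 'cV[k]_4) :=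
  [set C | [/\ rational_curve d C, C `<=` hermitian_surface q A &
     exists i j : nat, admissible d i j /\
       exists2 F : 'M[k]_4, F \in unitmx & C = monomial_curve F d i j]].

End Curves.

(* Main.v *)
Require Import Defs.
From mathcomp Require Import all_boot all_order all_algebra.
From mathcomp Require Import fingroup perm finfield.
From mathcomp Require Import boolp classical_sets.
From mathcomp Require Import mpoly.
From mathcomp Require Import zify.
Set Implicit Arguments.
Unset Strict Implicit.
Unset Printing Implicit Defensive.
Import GRing.Theory.

(* Pulling the Hermitian form back to a monomial curve with exponents
   0 < i < j < d gives an invertible matrix B with sum_(l, m) B_lm t^(a_l + q a_m)
   = 0, so B_lm = 0 unless the exponent a_l + q a_m is attained twice.  No row
   and no column of B vanishes, hence every exponent takes part in relations
   "a difference of exponents is q times another one"; these linear relations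
   leave only the exponents of the theorem, up to reversal (and 0, 1, 3, 4 for
   q = 2).

   All the resulting curves have exponents 0, i, i + q b, q c (in some order)
   with i and c prime to p.  Up to the action of the torus the general point is
   (1, 1, 1, 1), where the tangent line is spanned by e_o + e_w and e_i + e_j.
   At an end point with local exponents a_l, the tangent space contains e_l
   whenever a_l is not a nontrivial sum of local exponents, which decides
   smoothness.

   The tangent line at the point of parameter t depends on t^q only, so the
   dual variety is stable under diag (u^c, u^b, 1, 1), a root of the torus.
   Hence c h_o x_o + b h_i x_i = 0 on the conormal variety of the dual, whereas
   this form does not vanish at x = (1, 1, 1, 1), h = e_w - e_o. *)

(** * Arithmetic of the exponents *)

Definition collision (a : seq nat) q l m l' m' :=
  [/\ l' < 4, m' < 4, (l', m') <> (l, m) &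
      nth 0 a l + q * nth 0 a m = nth 0 a l' + q * nth 0 a m'].

(* The exponents are 0, x, x + y, x + y + z, and X, Y, Z stand for q x, q y,
   q z.  A collision says that a difference of exponents is q times another
   one; the next three predicates list the cases where the l-th or the m-th
   exponent takes part.  Reversing the exponents exchanges x and z. *)
Definition end_column_relation (x y z X Y Z : nat) :=
  X = y \/ X = z \/ X = y + z \/ X = x + y \/ X = x + y + z \/
  X + Y = z \/ X + Y = y + z \/ X + Y = x + y + z.

Definition end_row_relation (x y z X Y Z : nat) :=
  x = Y \/ x = Z \/ x = Y + Z \/ x + y = X \/ x + y = Y \/ x + y = Z \/
  x + y = Y + Z \/ x + y + z = X \/ x + y + z = Y \/ x + y + z = Z \/
  x + y + z = X + Y \/ x + y + z = Y + Z.

Definition middle_row_relation (x y z X Y Z : nat) :=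
  x = Y \/ x = Z \/ x = Y + Z \/ y = X \/ y = Z \/ y + z = X \/ y + z = Y \/
  y + z = Z \/ y + z = X + Y.

(** Fixing the four indices turns a collision into a linear equation in x, y, z, X, Y, Z. Given 2 x
    <= X, 2 y <= Y and 2 z <= Z, each of these finitely many equations is either impossible or one
    of those listed. *)
Lemma collision_relations x y z q X Y Z l m l' m' :
  1 < q -> 0 < x -> 0 < y -> 0 < z -> X = q * x -> Y = q * y -> Z = q * z ->
  l < 4 -> m < 4 ->
  collision [:: 0; x; x + y; x + y + z] q l m l' m' ->
  [/\ l = 0 -> end_row_relation x y z X Y Z,
      l = 3 -> end_row_relation z y x Z Y X,
      l = 1 -> middle_row_relation x y z X Y Z &
      l = 2 -> middle_row_relation z y x Z Y X] /\
  [/\ m = 0 -> end_column_relation x y z X Y Z &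
      m = 3 -> end_column_relation z y x Z Y X].
Proof.
move=> q_gt1 hx hy hz eX eY eZ hl hm [hl' hm' ne].
have hX : 2 * x <= X by rewrite eX leq_mul2r q_gt1 orbT.
have hY : 2 * y <= Y by rewrite eY leq_mul2r q_gt1 orbT.
have hZ : 2 * z <= Z by rewrite eZ leq_mul2r q_gt1 orbT.
have e1 : q * (x + y) = X + Y by lia.
have e2 : q * (x + y + z) = X + Y + Z by lia.
clear q_gt1; move: hl hm hl' hm' ne.
move: l => [|[|[|[|l]]]] // _; move: m => [|[|[|[|m]]]] // _;
move: l' => [|[|[|[|l']]]] // _; move: m' => [|[|[|[|m']]]] // _ //= ne;
rewrite ?muln0 -?eX -?eY -?eZ ?e1 ?e2; clear eX eY eZ e1 e2 ne q => e;
try (exfalso; lia).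
all: split; split=> // _.
all: unfold end_row_relation, middle_row_relation, end_column_relation.
all: by repeat first [left; lia | right]; lia.
Qed.

Lemma difference_ratios x y z q X Y Z :
  1 < q -> 0 < x -> 0 < y -> 0 < z -> X = q * x -> Y = q * y -> Z = q * z ->
  end_column_relation x y z X Y Z -> end_column_relation z y x Z Y X ->
  end_row_relation x y z X Y Z -> end_row_relation z y x Z Y X ->
  middle_row_relation x y z X Y Z -> middle_row_relation z y x Z Y X ->
  (x = z /\ X = x + y) \/ (X = x + y + z /\ y = Z) \/
  (Z = x + y + z /\ y = X) \/ (q = 2 /\ x = z /\ y = 2 * x).
Proof.
move=> q_gt1 hx hy hz eX eY eZ c0 c3 r0 r3 r1 r2.
(* Naming the multiples by q^2 lets each column relation be used a second time, multiplied by q,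
   while all constraints stay linear. *)
pose XX := q * X; pose YY := q * Y; pose ZZ := q * Z.
have eXX : XX = q * X by []. have eYY : YY = q * Y by [].
have eZZ : ZZ = q * Z by [].
clearbody XX YY ZZ.
have hq : (q = 2 /\ X = 2 * x /\ Y = 2 * y /\ Z = 2 * z) \/
    (3 <= q /\ 3 * x <= X /\ 3 * y <= Y /\ 3 * z <= Z /\
     3 * X <= XX /\ 3 * Y <= YY /\ 3 * Z <= ZZ).
  have [q_gt2|q_le2] := ltnP 2 q; last first.
    by left; have q2 : q = 2 by [apply/eqP; rewrite eqn_leq q_le2]; subst q.
  right; rewrite eXX eYY eZZ eX eY eZ.
  by do !split => //; rewrite leq_mul2r q_gt2 orbT.
(* Multiplication by q at least doubles a gap; this monotonicity is what the linear solver cannot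
   recover from the named products. *)
have xz : (x = z /\ X = Z /\ XX = ZZ) \/
    (x < z /\ X + 2 * (z - x) <= Z /\ XX + 2 * (Z - X) <= ZZ) \/
    (z < x /\ Z + 2 * (x - z) <= X /\ ZZ + 2 * (X - Z) <= XX).
  have mulq u v : u <= v -> q * u + 2 * (v - u) <= q * v.
    move=> uv; rewrite -leq_subRL ?leq_mul2l ?uv ?orbT // -mulnBr.
    by rewrite leq_mul2r q_gt1 orbT.
  have monoq u v : u < v -> q * u <= q * v by move=> /ltnW; exact: leq_mul.
  case: (ltngtP x z) => [xz|zx|e]; [right; left|right; right|left].
  - by rewrite eXX eZZ eX eZ; do !split => //; apply: mulq; rewrite ?monoq // ltnW.
  - by rewrite eXX eZZ eX eZ; do !split => //; apply: mulq; rewrite ?monoq // ltnW.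
  - by rewrite eXX eZZ eX eZ e.
move: c0 c3.
case=> [c0|[c0|[c0|[c0|[c0|[c0|[c0|c0]]]]]]];
case=> [c3|[c3|[c3|[c3|[c3|[c3|[c3|c3]]]]]]];
have {}c0 := conj c0 (congr1 (muln q) c0);
have {}c3 := conj c3 (congr1 (muln q) c3);
rewrite ?mulnDr -?eXX -?eYY -?eZZ -?eX -?eY -?eZ in c0 c3;
clear q_gt1 eX eY eZ eXX eYY eZZ.
all: try by exfalso; clear r0 r1 r2 r3; lia.
all: try by left; clear r0 r1 r2 r3; lia.
all: try by right; left; clear r0 r1 r2 r3; lia.
all: try by right; right; left; clear r0 r1 r2 r3; lia.
all: try by exfalso; clear r3 r1 r2; unfold end_row_relation in *; lia.
all: try by exfalso; clear r0 r1 r2; unfold end_row_relation in *; lia.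
all: try by exfalso; clear r0 r3 r2; unfold middle_row_relation in *; lia.
all: try by exfalso; clear r0 r3 r1; unfold middle_row_relation in *; lia.
(* Three pairs of column relations remain; the row relation [r0] rules them out for q at least 3,
   and q = 2 leaves the extra solution. *)
all: (case: hq => hq; last by exfalso; clear r1 r2 r3 xz; unfold end_row_relation in *; lia).
all: clear r0 r3 xz; move: hq => [q2 [hX [hY hZ]]]; subst q X Y Z.
- by right; right; right; clear r1 r2; lia.
- have [e|e] : y = z \/ y = 2 * z by clear r2; unfold middle_row_relation in *; lia.
    by exfalso; clear r1; unfold middle_row_relation in *; lia.
  by clear r1 r2; lia.
- have [e|e] : y = x \/ y = 2 * x by clear r1; unfold middle_row_relation in *; lia.
    by exfalso; clear r2; unfold middle_row_relation in *; lia.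
  by clear r1 r2; lia.
Qed.

Lemma coprime_cross_mul u v x z :
  coprime u v -> coprime x z -> u * x = v * z -> x = v /\ z = u.
Proof.
move=> uv xz e.
have vx : v %| x by rewrite -(@Gauss_dvdr v u) 1?coprime_sym // e dvdn_mulr.
have xv : x %| v by rewrite -(@Gauss_dvdl x v z) // -e dvdn_mull.
have uz : u %| z by rewrite -(@Gauss_dvdr u v) // -e dvdn_mulr.
have zu : z %| u by rewrite -(@Gauss_dvdl z u x) 1?coprime_sym // e dvdn_mull.
by split; apply/eqP; rewrite eqn_dvd ?xv ?vx ?uz ?zu.
Qed.

(** The fraction x / z is (q + 1) / (q - 1) in lowest terms, and [(odd q).+1] is the gcd of q + 1
    and q - 1. *)
Lemma coprime_adjacent_ratio q x z :
  1 < q -> coprime x z -> (q - 1) * x = (q + 1) * z ->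
  (odd q).+1 * x = q.+1 /\ (odd q).+1 * z = q - 1.
Proof.
move=> q_gt1 xz e; case: (boolP (odd q)) => odd_q.
  have [r er] : exists r, q = 2 * r + 1.
    by exists q./2; rewrite -[q in LHS]odd_double_half odd_q -mul2n addnC.
  have [-> ->] : x = r.+1 /\ z = r; last by lia.
  by apply: coprime_cross_mul => //; [exact: coprimenS | lia].
rewrite !mul1n -addn1; apply: coprime_cross_mul => //.
have [r er] : exists r, q = 2 * r.
  by exists q./2; rewrite -[q in LHS]odd_double_half (negbTE odd_q) -mul2n.
rewrite /coprime (_ : q + 1 = 2 + (q - 1)); last by lia.
rewrite gcdnDr -/(coprime _ _) coprimen2.
by rewrite er; case: r er => [|r] er; [lia|rewrite mulnS addnC -addnBA //= oddD oddM].
Qed.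

(** The relations fix the ratios of the successive gaps x, y, z of the exponents, and the gcd
    condition then fixes the gaps themselves. The third outcome is the reversal of the second. *)
Lemma exponents_classification q i j d :
  1 < q -> 0 < i < j -> j < d -> gcdn d (gcdn i j) = 1 -> ~ (q = 2 /\ d = 4) ->
  (forall l, l < 4 -> exists m l' m', m < 4 /\ collision [:: 0; i; j; d] q l m l' m') ->
  (forall m, m < 4 -> exists l l' m', l < 4 /\ collision [:: 0; i; j; d] q l m l' m') ->
  [\/ [/\ d = q.+1, i = 1 & j = q],
      exists g, [/\ g = (odd q).+1, g * d = q * q.+1, g * i = q.+1 & g * j = (q ^ 2).+1] |
      exists g, [/\ g = (odd q).+1, g * d = q * q.+1, g * i = q - 1 & g * j = q ^ 2 - 1]].
Proof.
move=> q_gt1 /andP[i_gt0 ij] jd gcd1 not_2_4 rows cols.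
pose x := i; pose y := j - i; pose z := d - j.
have [hx hy hz] : [/\ 0 < x, 0 < y & 0 < z] by rewrite /x /y /z !subn_gt0.
have ej : j = x + y by rewrite /x /y; lia.
have ed : d = x + y + z by rewrite /x /y /z; lia.
have ex : i = x by [].
move: rows cols gcd1 not_2_4; rewrite ej ed ex => rows cols gcd1 not_2_4.
clearbody x y z; clear i j d ij jd i_gt0 ex ej ed.
have row l (hl : l < 4) : [/\ l = 0 -> end_row_relation x y z (q * x) (q * y) (q * z),
      l = 3 -> end_row_relation z y x (q * z) (q * y) (q * x),
      l = 1 -> middle_row_relation x y z (q * x) (q * y) (q * z) &
      l = 2 -> middle_row_relation z y x (q * z) (q * y) (q * x)].
  have [m [l' [m' [hm c]]]] := rows l hl.
  by have [] := collision_relations q_gt1 hx hy hz erefl erefl erefl hl hm c.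
have col m (hm : m < 4) : [/\ m = 0 -> end_column_relation x y z (q * x) (q * y) (q * z) &
      m = 3 -> end_column_relation z y x (q * z) (q * y) (q * x)].
  have [l [l' [m' [hl c]]]] := cols m hm.
  by have [] := collision_relations q_gt1 hx hy hz erefl erefl erefl hl hm c.
have [/(_ erefl) r0 _ _ _] := row 0 isT.
have [_ _ /(_ erefl) r1 _] := row 1 isT.
have [_ _ _ /(_ erefl) r2] := row 2 isT.
have [_ /(_ erefl) r3 _ _] := row 3 isT.
have [/(_ erefl) c0 _] := col 0 isT.
have [_ /(_ erefl) c3] := col 3 isT.
have g_dvd g : g %| x -> g %| y -> g %| z -> g = 1.
  move=> gx gy gz; apply/eqP; rewrite -dvdn1 -gcd1 !dvdn_gcd gx.
  by rewrite !dvdn_add ?gx ?gy ?gz.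
(* Eliminating the middle gap leaves the ratio of the two outer ones; the reversed case applies this
   with x and z exchanged. *)
have ratio u v w : q * u = u + v + w -> v = q * w -> (q - 1) * u = (q + 1) * w.
  move=> e1 e2; rewrite mulnBl mul1n e1 e2 mulnDl mul1n; lia.
have [[exz e]|[[e ey]|[[e ey]|[q2 [exz ey]]]]] :=
    difference_ratios q_gt1 hx hy hz erefl erefl erefl c0 c3 r0 r3 r1 r2.
- have y_def : y = (q - 1) * x by rewrite mulnBl mul1n e addnC addnK.
  have x1 : x = 1 by apply: g_dvd; rewrite ?dvdnn // -?exz ?dvdnn // y_def dvdn_mull.
  by apply: Or31; rewrite -exz y_def x1; split=> //; lia.
- apply: Or32; exists (odd q).+1.
  have xz : coprime x z.
    apply/eqP; apply: g_dvd; rewrite ?dvdn_gcdl ?dvdn_gcdr //.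
    by rewrite ey dvdn_mull // dvdn_gcdr.
  have [gx gz] := coprime_adjacent_ratio q_gt1 xz (ratio x y z e ey).
  rewrite -e ey mulnDr [_ * (q * x)]mulnCA [_ * (q * z)]mulnCA gx gz.
  by split=> //; lia.
- apply: Or33; exists (odd q).+1.
  have zx : coprime z x.
    apply/eqP; apply: g_dvd; rewrite ?dvdn_gcdl ?dvdn_gcdr //.
    by rewrite ey dvdn_mull // dvdn_gcdr.
  have e' : q * z = z + y + x by rewrite e; lia.
  have [gz gx] := coprime_adjacent_ratio q_gt1 zx (ratio z y x e' ey).
  rewrite -e ey mulnDr [_ * (q * x)]mulnCA [_ * (q * z)]mulnCA gx gz.
  by split=> //; lia.
- case: not_2_4; split=> //.
  by have x1 : x = 1 by [apply: g_dvd; rewrite ?dvdnn // -?exz // ey dvdn_mull]; lia.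
Qed.

(** * Arithmetic of the exponents (q + 1)/g, (q^2 + 1)/g, q (q + 1)/g *)

Section Family.
Variables (q d i j : nat).
Hypothesis q_gt1 : 1 < q.
Local Notation g := (odd q).+1.
Hypotheses (gd : g * d = q * q.+1) (gi : g * i = q.+1) (gj : g * j = (q ^ 2).+1).

Let cancel_g x y : g * x = g * y -> x = y.
Proof. by move=> /eqP; rewrite eqn_pmul2l // => /eqP. Qed.

Let q_sqr : 2 * q <= q ^ 2.
Proof. by rewrite -mulnn leq_mul2r q_gt1 orbT. Qed.

Let g_mul_sub x y : g * (x - y) = g * x - g * y.
Proof. exact: mulnBr. Qed.

Lemma family_arith : [/\ d = q * i, 0 < i, i < j & j < d].
Proof.
have e : q * q.+1 = q ^ 2 + q by rewrite mulnS addnC mulnn.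
split.
- by apply: cancel_g; rewrite gd mulnCA gi.
- by rewrite -(ltn_pmul2l (ltn0Sn (odd q))) muln0 gi.
- by rewrite -(ltn_pmul2l (ltn0Sn (odd q))) gi gj; lia.
- by rewrite -(ltn_pmul2l (ltn0Sn (odd q))) gd gj e; lia.
Qed.

(** Since q^2 + 1 = (q + 1) + q (q - 1), the quotient b is (q - 1)/g, written below as i - 2/g. In
    characteristic p the two middle exponents thus become equal. *)
Lemma family_middle : exists b, j = i + q * b.
Proof.
have gr : g * (2 %/ g) = 2 by case: (odd q).
exists (i - 2 %/ g); apply: cancel_g.
rewrite mulnDr gj gi mulnCA g_mul_sub gi gr mulnBr mulnS mulnn; lia.
Qed.

(** Modulo q + 1 the number q^2 + 1 is 2, and q + 1 > 2. *)
Lemma family_not_dvd_start : ~~ (i %| j).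
Proof.
apply/negP => /dvdnP[r ej].
have e : r * q.+1 = (q ^ 2).+1 by rewrite -gi mulnCA -ej gj.
have : q.+1 %| 2.
  have -> : 2 = (q ^ 2).+1 - (q - 1) * q.+1.
    by rewrite mulnBl mul1n mulnS mulnn; lia.
  by rewrite dvdn_sub // ?dvdn_mull // -e dvdn_mull.
by move=> /dvdn_leq; lia.
Qed.

Lemma family_end_arith :
  [/\ g * (d - j) = q - 1, g * (d - i) = q ^ 2 - 1 & d - i = q.+1 * (d - j)].
Proof.
have e : q * q.+1 = q ^ 2 + q by rewrite mulnS addnC mulnn.
have e1 : g * (d - j) = q - 1 by rewrite g_mul_sub gd gj e; lia.
have e2 : g * (d - i) = q ^ 2 - 1 by rewrite g_mul_sub gd gi e; lia.
split=> //; apply: cancel_g.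
by rewrite mulnCA e1 e2 mulnBr mulSn mulnn muln1; lia.
Qed.

(** Modulo q - 1 the number q (q + 1) is 2, and q - 1 > 2 exactly when q > 3; this is the origin of
    the bound 3. *)
Lemma family_not_dvd_end : 3 < q -> ~~ (d - j %| d).
Proof.
move=> q_gt3; have [e1 _ _] := family_end_arith.
apply/negP => /dvdnP[r ed].
have e : r * (q - 1) = q * q.+1 by rewrite -e1 mulnCA -ed gd.
have : q - 1 %| 2.
  have -> : 2 = q * q.+1 - (q + 2) * (q - 1).
    by rewrite mulnBr muln1 mulnDl mulnS mulnn; lia.
  by apply: dvdn_sub; rewrite -?e dvdn_mull.
by move=> /dvdn_leq; lia.
Qed.

(** For q = 2 and q = 3 the quotient (q - 1)/g is 1, so the coordinate with exponent j is a local
    parameter at the end point. *)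
Lemma family_small_end : q <= 3 -> [/\ d - j = 1, 1 < d - i & 1 < d].
Proof.
have [di i_gt0 ij jd] := family_arith; have [e1 e2 _] := family_end_arith.
move=> q_le3; have [q2|q3] : q = 2 \/ q = 3 by lia.
  by move: e1 e2; rewrite q2 /= -mulnn => e1 e2; split; lia.
by move: e1 e2; rewrite q3 /= -mulnn => e1 e2; split; lia.
Qed.

End Family.

Local Open Scope classical_set_scope.
Local Open Scope ring_scope.

(** * Polynomials along curves, linear substitutions *)

Section PolynomialCurves.
Variables (k : fieldType) (m : nat).
Implicit Types (f : {mpoly k[m]}) (c : 'I_m -> {poly k}) (x v : 'cV[k]_m).

Definition along c f : {poly k} := mmap polyC c f.

Lemma mderivXU i j : ('X_j)^`M(i) = (j == i)%:R :> {mpoly k[m]}.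
Proof.
rewrite mderivX mnm1E; have [->|_] := eqVneq j i; last by rewrite scale0r.
by rewrite scale1r -[X in (X - _)%MM]add0m addmK mpolyX0.
Qed.

(** Induction along the ring structure: evaluation and derivation identities need checking only on
    constants and variables, then through sums and products. *)
Lemma mpoly_ring_ind (P : {mpoly k[m]} -> Prop) :
  (forall a, P a%:MP) -> (forall i, P 'X_i) ->
  (forall f g, P f -> P g -> P (f + g)) -> (forall f g, P f -> P g -> P (f * g)) ->
  forall f, P f.
Proof.
move=> PC PX PD PM; elim/mpolyind => [|a n f _ _ Pf]; first by rewrite -mpolyC0.
apply: (PD) => //; rewrite -mul_mpolyC mpolyXE_id; apply: (PM) => //.
apply: big_ind => [||i _]; [by rewrite -mpolyC1 | exact: PM |].
by elim: (n i) => [|e IH]; rewrite ?expr0 -?mpolyC1 // exprS; apply: PM.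
Qed.

Lemma horner_along c f t : (along c f).[t] = f.@[fun i => (c i).[t]].
Proof.
elim/mpoly_ring_ind: f => [a|i|f g|f g]; rewrite /along.
- by rewrite mmapC hornerC mevalC.
- by rewrite mmapX mmap1U mevalXU.
- by rewrite mmapD hornerD mevalD => -> ->.
- by rewrite rmorphM /= hornerM mevalM => -> ->.
Qed.

Lemma deriv_along c f :
  (along c f)^`() = \sum_(i < m) along c f^`M(i) * (c i)^`().
Proof.
elim/mpoly_ring_ind: f => [a|i|f g|f g]; rewrite /along.
- by rewrite mmapC derivC big1 // => i _; rewrite mderivC mmap0 mul0r.
- rewrite mmapX mmap1U (bigD1 i) //= big1 ?addr0 => [|j ji].
    by rewrite mderivXU eqxx rmorph1 mul1r.
  by rewrite mderivXU eq_sym (negbTE ji) mmap0 mul0r.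
- move=> ef eg; rewrite mmapD derivD ef eg -big_split; apply: eq_bigr => i _.
  by rewrite mderivD mmapD mulrDl.
- move=> ef eg; rewrite rmorphM /= derivM ef eg mulr_suml mulr_sumr -big_split.
  apply: eq_bigr => i _; rewrite mderivM mmapD !rmorphM /= mulrDl -!mulrA.
  by congr (_ * _ + _); rewrite mulrC.
Qed.

Definition line x v (i : 'I_m) : {poly k} := (x i 0)%:P + (v i 0)%:P * 'X.

Lemma deriv_along_line x v f :
  (along (line x v) f)^`().[0] = \sum_(i < m) mevalc (f^`M(i)) x * v i 0.
Proof.
rewrite deriv_along horner_sum; apply: eq_bigr => i _.
rewrite hornerM horner_along /line derivD derivC add0r derivM derivC derivX.
rewrite mul0r add0r mulr1 hornerC; congr (_ * _); apply: meval_eq => j.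
by rewrite !hornerE /= ?mulr0 ?addr0.
Qed.

End PolynomialCurves.

Section LinearSubstitution.
Variables (k : fieldType) (m n : nat).
Implicit Types (M : 'M[k]_(m, n)) (f : {mpoly k[m]}) (x v : 'cV[k]_n).

Definition linsub M : m.-tuple {mpoly k[n]} :=
  [tuple \sum_(j < n) M i j *: 'X_j | i < m].

Lemma mevalc_linsub M f x : mevalc (f \mPo linsub M) x = mevalc f (M *m x).
Proof.
rewrite /mevalc comp_mpoly_meval; apply: meval_eq => i.
rewrite tnth_mktuple raddf_sum mxE; apply: eq_bigr => j _.
by rewrite /= mevalZ mevalXU.
Qed.

Lemma along_comp (c : 'I_n -> {poly k}) (t : m.-tuple {mpoly k[n]}) f :
  along c (f \mPo t) = along (fun i => along c (tnth t i)) f.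
Proof.
elim/mpoly_ring_ind: f => [a|i|f g|f g].
- by rewrite comp_mpolyC /along !mmapC.
- by rewrite comp_mpolyXU /along mmapX mmap1U -tnth_nth.
- by rewrite comp_mpolyD /along !mmapD => -> ->.
- by rewrite /along !rmorphM /= => -> ->.
Qed.

(** Chain rule: f after M along the line x + T v is f along the line M x + T M v, and both sides are
    the derivative at T = 0. *)
Lemma mderiv_linsub M f x v :
  \sum_(i < n) mevalc ((f \mPo linsub M)^`M(i)) x * v i 0 =
  \sum_(i < m) mevalc (f^`M(i)) (M *m x) * (M *m v) i 0.
Proof.
rewrite -!deriv_along_line along_comp; congr (_^`().[0]).
congr (mmap _ _ f); apply/funext => i; rewrite tnth_mktuple /along raddf_sum /line.
rewrite !mxE !rmorph_sum mulr_suml -big_split; apply: eq_bigr => j _ /=.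
by rewrite mmapZ mmapX mmap1U mulrDr !polyCM mulrA.
Qed.

End LinearSubstitution.

(** * Linear changes of coordinates *)

Section Transport.
Variables (k : fieldType) (m : nat).
Implicit Types (X : set 'cV[k]_m) (S : set ('cV[k]_m * 'cV[k]_m)).
Implicit Types (x v h : 'cV[k]_m) (M N : 'M[k]_m).

Lemma proj_image_mul M N X : proj_image M (proj_image N X) = proj_image (M *m N) X.
Proof.
apply/seteqP; split=> y /=.
  by move=> [_ [x Xx <-] <-]; exists x; rewrite // mulmxA.
by move=> [x Xx <-]; exists (N *m x); [exists x | rewrite mulmxA].
Qed.

Lemma proj_image1 X : proj_image 1%:M X = X.
Proof.
apply/seteqP; split=> y /=; first by move=> [x Xx <-]; rewrite mul1mx.
by move=> Xy; exists y; rewrite ?mul1mx.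
Qed.

Lemma proj_imageK M X : M \in unitmx -> proj_image (invmx M) (proj_image M X) = X.
Proof. by move=> uM; rewrite proj_image_mul mulVmx // proj_image1. Qed.

Lemma mulmx_neq0 M x : M \in unitmx -> x != 0 -> M *m x != 0.
Proof.
move=> uM; apply: contraNneq => e.
by rewrite -(mul1mx x) -(mulVmx uM) -mulmxA e mulmx0.
Qed.

Lemma vanishes_on_image M X (f : {mpoly k[m]}) :
  vanishes_on (proj_image M X) f <-> vanishes_on X (f \mPo linsub M).
Proof.
split=> f0 x; first by move=> Xx; rewrite mevalc_linsub; apply: f0; exists x.
by move=> [y Xy <-]; rewrite -mevalc_linsub; apply: f0.
Qed.

Lemma tangent_image M X x v :
  tangent X x v -> tangent (proj_image M X) (M *m x) (M *m v).
Proof.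
move=> Tv f /vanishes_on_image f0; rewrite -mderiv_linsub.
exact: Tv.
Qed.

Lemma tangent_imageE M X x v : M \in unitmx ->
  tangent (proj_image M X) (M *m x) (M *m v) <-> tangent X x v.
Proof.
move=> uM; split; last exact: tangent_image.
by move=> /(@tangent_image (invmx M) _ _ _); rewrite proj_imageK // !mulKmx.
Qed.


Lemma alg_indep_on_image M X n (f : n.-tuple {mpoly k[m]}) :
  alg_indep_on (proj_image M X) f ->
  alg_indep_on X [tuple of [seq p \mPo linsub M | p <- f]].
Proof.
move=> ind P P0; apply: ind => _ [x Xx <-].
rewrite -(P0 x Xx) /mevalc !comp_mpoly_meval; apply: meval_eq => i.
by rewrite tnth_map -!/(mevalc _ _) mevalc_linsub.
Qed.

Lemma has_dim_image M X r : M \in unitmx -> has_dim X r -> has_dim (proj_image M X) r.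
Proof.
move=> uM [[f indf] no]; split; last first.
  by move=> [g /alg_indep_on_image indg]; apply: no; eexists; exact: indg.
exists [tuple of [seq p \mPo linsub (invmx M) | p <- f]].
by apply: alg_indep_on_image; rewrite proj_imageK.
Qed.

Lemma smooth_point_image M X x : M \in unitmx ->
  smooth_point X x -> smooth_point (proj_image M X) (M *m x).
Proof.
move=> uM [Xx [r dimX [U TU dimU]]]; split; first by exists x.
exists r; first exact: has_dim_image.
pose F : 'End('cV[k]_m) := linfun (mulmx M).
exists (F @: U)%VS; last first.
  rewrite limg_dim_eq // (_ : lker F = 0%VS) ?capv0 //.
  by apply/eqP/lker0P => u v; rewrite !lfunE /= => /(can_inj (mulKmx uM)).
apply/seteqP; split=> w /=.
  move=> Tw; apply/memv_imgP; exists (invmx M *m w); last by rewrite lfunE /= mulKVmx.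
  suff : tangent X x (invmx M *m w) by rewrite TU.
  by apply/(tangent_imageE _ _ _ uM); rewrite mulKVmx.
move=> /memv_imgP[u Uu ->]; rewrite lfunE /=.
by apply: tangent_image; rewrite TU.
Qed.

Lemma smooth_point_imageE M X x : M \in unitmx ->
  smooth_point (proj_image M X) (M *m x) <-> smooth_point X x.
Proof.
move=> uM; split; last exact: smooth_point_image.
have uV : invmx M \in unitmx by rewrite unitmx_inv.
by move=> /(smooth_point_image uV); rewrite proj_imageK // mulKmx.
Qed.

Lemma singular_locus_image M X : M \in unitmx ->
  singular_locus (proj_image M X) = proj_image M (singular_locus X).
Proof.
move=> uM; apply/seteqP; split=> [_ [[x Xx <-]]|_ [x [Xx sx] <-]].
  by move=> sx; exists x => //; split=> // /(smooth_point_imageE _ _ uM).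
by split; [exists x | move/(smooth_point_imageE _ _ uM)].
Qed.

Lemma nonsingular_image M X : M \in unitmx ->
  nonsingular X -> nonsingular (proj_image M X).
Proof. by move=> uM sX _ [x Xx <-]; apply: smooth_point_image => //; apply: sX. Qed.

(** Hyperplanes move by the inverse transpose, which preserves the pairing of h with tangent
    vectors. *)
Lemma tangent_pairs_image M X x h : M \in unitmx -> tangent_pairs X (x, h) ->
  tangent_pairs (proj_image M X) (M *m x, (invmx M)^T *m h).
Proof.
move=> uM [/= sx h0 Th]; split=> /=; first exact: smooth_point_image.
  by apply: mulmx_neq0; rewrite // unitmx_tr unitmx_inv.
move=> w Tw; rewrite trmx_mul trmxK -mulmxA; apply: Th.
by apply/(tangent_imageE _ _ _ uM); rewrite mulKVmx.
Qed.

Lemma biclosure_image M N S S' : M \in unitmx -> N \in unitmx ->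
  (forall x h, S (x, h) -> S' (M *m x, N *m h)) ->
  forall x h, biclosure S (x, h) -> biclosure S' (M *m x, N *m h).
Proof.
move=> uM uN SS' x h [/= x0 h0 clS]; split=> /=; try exact: mulmx_neq0.
move=> f f0; have e y g :
    col_mx (M *m y) (N *m g) = block_mx M 0 0 N *m col_mx y g.
  by rewrite mul_block_col !mul0mx addr0 add0r.
rewrite e -mevalc_linsub; apply: clS => -[y g] /= Syg.
by rewrite mevalc_linsub -e; apply: (f0 (_, _)); exact: SS'.
Qed.

Lemma conormal_image M X x h : M \in unitmx -> conormal X (x, h) ->
  conormal (proj_image M X) (M *m x, (invmx M)^T *m h).
Proof.
move=> uM; apply: biclosure_image => //; first by rewrite unitmx_tr unitmx_inv.
by move=> y g; exact: tangent_pairs_image.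
Qed.

Lemma conormal_imageE M X x h : M \in unitmx ->
  conormal (proj_image M X) (M *m x, (invmx M)^T *m h) <-> conormal X (x, h).
Proof.
move=> uM; split; last exact: conormal_image.
have uV : invmx M \in unitmx by rewrite unitmx_inv.
move=> /(conormal_image uV); rewrite proj_imageK // mulKmx // invmxK.
by rewrite trmx_inv mulKVmx // unitmx_tr.
Qed.

Lemma dual_variety_image M X : M \in unitmx ->
  dual_variety (proj_image M X) = proj_image (invmx M)^T (dual_variety X).
Proof.
move=> uM; apply/seteqP; split=> [h [y cy]|_ [h [x cx] <-]]; last first.
  by exists (M *m x); exact: conormal_image.
exists (M^T *m h); last by rewrite trmx_inv mulKmx // unitmx_tr.
exists (invmx M *m y); apply/(conormal_imageE _ _ _ uM).
by rewrite mulKVmx // trmx_inv mulKmx // unitmx_tr.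
Qed.

Lemma reflexive_image M X : M \in unitmx ->
  reflexive_variety X -> reflexive_variety (proj_image M X).
Proof.
move=> uM reflX; have uN : (invmx M)^T \in unitmx by rewrite unitmx_tr unitmx_inv.
have uV : invmx M \in unitmx by rewrite unitmx_inv.
(* Dualising twice gives back [M], so both conormal varieties are transformed by the same pair of
   matrices. *)
have eN : (invmx (invmx M)^T)^T = M by rewrite trmx_inv trmxK invmxK.
have E x h : conormal X (x, h) <-> conormal (dual_variety X) (h, x).
  by rewrite (reflX : conormal X = _).
rewrite /reflexive_variety dual_variety_image //; apply/seteqP.
have key x h : conormal (proj_image M X) (x, h) <->
    conormal (proj_image (invmx M)^T (dual_variety X)) (h, x).
  have a := conormal_imageE X (invmx M *m x) (M^T *m h) uM.
  have b := conormal_imageE (dual_variety X) (M^T *m h) (invmx M *m x) uN.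
  rewrite eN mulKVmx // trmx_inv mulKmx ?unitmx_tr // in b.
  rewrite mulKVmx // trmx_inv mulKmx ?unitmx_tr // in a.
  by rewrite trmx_inv; split=> [/a /E /b|/b /E /a].
by split=> -[x h] /key.
Qed.

Lemma proj_isomorphic_reflexive X Y :
  proj_isomorphic X Y -> reflexive_variety X -> reflexive_variety Y.
Proof.
move=> [M uM ->] reflX; rewrite -(proj_imageK Y uM); apply: reflexive_image => //.
by rewrite unitmx_inv.
Qed.

End Transport.

(** * Algebraic dependence *)

Lemma ord2_cases (i : 'I_2) : i = ord0 \/ i = ord_max.
Proof. by case: i => [[|[|//]] hi]; [left|right]; apply: val_inj. Qed.

Section Dependence.
Variable k : fieldType.

Lemma kernel_vector (m n : nat) (A : 'M[k]_(m, n)) : (n < m)%N ->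
  exists2 u : 'rV[k]_m, u != 0 & u *m A = 0.
Proof.
move=> nm; have : kermx A != 0.
  rewrite -mxrank_eq0 mxrank_ker subn_eq0 -ltnNge.
  exact: leq_ltn_trans (rank_leq_col A) nm.
move=> /rowV0Pn[u /sub_kermxP uA u0]; by exists u.
Qed.

Lemma msize_mul_le n (p r : {mpoly k[n]}) u v :
  (msize p <= u.+1)%N -> (msize r <= v.+1)%N -> (msize (p * r) <= (u + v).+1)%N.
Proof.
move=> pu rv; have [->|p0] := eqVneq p 0; first by rewrite mul0r msize0.
have [->|r0] := eqVneq r 0; first by rewrite mulr0 msize0.
rewrite msizeM // -ltnS prednK ?ltnS ?(leq_trans (leq_add pu rv)) ?addSn ?addnS //.
by rewrite addn_gt0 lt0n msize_poly_eq0 p0.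
Qed.

Lemma msize_exp_le n (p : {mpoly k[n]}) M e :
  (msize p <= M)%N -> (msize (p ^+ e) <= (e * M).+1)%N.
Proof.
move=> pM; elim: e => [|e IH]; first by rewrite expr0 msize1.
by rewrite exprS mulSn; apply: msize_mul_le => //; apply: leqW.
Qed.

(** Dimension count: the N^3 monomials in three of the polynomials, with exponents below N, have
    degree linear in N, hence lie in a space of dimension of order N^2. *)
Lemma mpoly2_dependent n (g : n.-tuple {mpoly k[2]}) : (2 < n)%N ->
  exists2 P : {mpoly k[n]}, P != 0 & P \mPo g = 0.
Proof.
move=> n_gt2.
have [i0 [i1 [i2 [n01 n02 n12]]]] : exists i0 i1 i2 : 'I_n, [/\ i0 != i1, i0 != i2 & i1 != i2].
  by exists (Ordinal (ltnW (ltnW n_gt2))), (Ordinal (ltnW n_gt2)), (Ordinal n_gt2).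
pose M := (msize (tnth g i0) + msize (tnth g i1) + msize (tnth g i2))%N.
(* The sizes of the products are at most D <= N (3 M + 1), so at most D^2 <= N^2 (3 M + 1)^2
   coefficients occur, fewer than N^3 because N exceeds (3 M + 1)^2. *)
pose N := ((3 * M).+1 ^ 2).+1; pose D := (3 * (N * M)).+1.
pose T : finType := ('I_N * 'I_N * 'I_N)%type.
pose mon (b : T) : 'X_{1..n} := (U_(i0) *+ b.1.1 + U_(i1) *+ b.1.2 + U_(i2) *+ b.2)%MM.
pose G (b : T) := tnth g i0 ^+ b.1.1 * tnth g i1 ^+ b.1.2 * tnth g i2 ^+ b.2.
have monE b : 'X_[mon b] \mPo g = G b.
  by rewrite !mpolyXD -!mpolyXn !rmorphM !rmorphXn /= !comp_mpolyXU -!tnth_nth.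
have mon_inj : injective mon.
  move=> [[a b] c] [[a' b'] c'] /mnmP e; move: (e i0) (e i1) (e i2).
  rewrite !mnmDE !mulmnE !mnm1E !eqxx [i1 == i0]eq_sym [i2 == i0]eq_sym [i2 == i1]eq_sym.
  rewrite (negbTE n01) (negbTE n02) (negbTE n12) !mul0n !mul1n !addn0 !add0n /=.
  by move=> /val_inj -> /val_inj -> /val_inj ->.
have sizeG b : (msize (G b) <= D)%N.
  have le_exp i (e : 'I_N) : (msize (tnth g i) <= M)%N ->
      (msize (tnth g i ^+ e) <= (N * M).+1)%N.
    move=> iM; apply: leq_trans (msize_exp_le e iM) _.
    by rewrite ltnS leq_mul2r ltnW ?orbT.
  have l0 : (msize (tnth g i0) <= M)%N by rewrite /M -addnA leq_addr.
  have l1 : (msize (tnth g i1) <= M)%N by rewrite /M addnAC leq_addl.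
  have l2 : (msize (tnth g i2) <= M)%N by rewrite /M leq_addl.
  have tri x : (3 * x = x + x + x)%N by rewrite !mulSn mul0n addn0 addnA.
  rewrite /D tri.
  by rewrite /G; apply: msize_mul_le; [apply: msize_mul_le|]; apply: le_exp.
pose C : finType := 'X_{1..2 < D}.
(* Row r holds the coefficients of one product, so a vector in the left kernel is a linear relation
   between the products. *)
pose A := \matrix_(r < #|T|, c < #|C|) (G (enum_val r))@_(val (enum_val c)).
have [|u u0 uA] := kernel_vector A.
  pose F (c : C) : 'I_D * 'I_D :=
    (inord (val c ord0), inord (val c ord_max)).
  have F_inj : injective F.
    move=> c c' [e0 e1]; apply/val_inj/mnmP => i.
    have le_deg (b : C) j : (val b j < D)%N.
      by apply: leq_ltn_trans (bmdeg b); rewrite mdegE (bigD1 j) //= leq_addr.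
    have {}e0 := congr1 val e0; have {}e1 := congr1 val e1.
    rewrite /= !inordK ?le_deg // in e0 e1.
    by have [->|->] := ord2_cases i.
  apply: leq_ltn_trans (leq_card F F_inj) _.
  rewrite !card_prod !card_ord; apply: (@leq_ltn_trans ((N * (3 * M).+1) ^ 2)).
    rewrite -mulnn leq_mul // /D mulnS mulnCA -add1n leq_add //.
  by rewrite expnMn -mulnn ltn_pmul2l // muln_gt0.
exists (\sum_(r < #|T|) u 0 r *: 'X_[mon (enum_val r)]).
  apply: contraNneq u0 => P0; apply/eqP/rowP => r.
  have := congr1 (mcoeff (mon (enum_val r))) P0.
  rewrite raddf_sum mcoeff0 (bigD1 r) //= big1 ?addr0 => [|r' r'r].
    by rewrite mcoeffZ mcoeffX eqxx mulr1 mxE.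
  by rewrite mcoeffZ mcoeffX (inj_eq mon_inj) (inj_eq enum_val_inj) (negbTE r'r) mulr0.
rewrite raddf_sum /=; apply/mpolyP => c; rewrite mcoeff0 raddf_sum /=.
have [cD|Dc] := ltnP (mdeg c) D; last first.
  rewrite big1 // => r _; rewrite comp_mpolyZ monE mcoeffZ memN_msupp_eq0 ?mulr0 //.
  by apply: msize_mdeg_ge; apply: leq_trans (sizeG _) Dc.
have /rowP/(_ (enum_rank (BMultinom cD))) := uA; rewrite !mxE => uA0.
rewrite -[RHS]uA0; apply: eq_bigr => r _.
by rewrite comp_mpolyZ monE mcoeffZ mxE enum_rankK.
Qed.

Lemma parametrized_dependent m n (X : set 'cV[k]_m) (t : m.-tuple {mpoly k[2]})
    (f : n.-tuple {mpoly k[m]}) :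
  (forall x, X x -> exists s, forall i, x i 0 = (tnth t i).@[s]) ->
  (2 < n)%N -> ~ alg_indep_on X f.
Proof.
move=> param n_gt2 indf.
have [P P0 Pg] := mpoly2_dependent [tuple of [seq p \mPo t | p <- f]] n_gt2.
case/eqP: P0; apply: indf => x /param[s xs].
rewrite -(@meval0 _ _ s) -Pg /mevalc !comp_mpoly_meval; apply: meval_eq => i.
by rewrite tnth_map comp_mpoly_meval; apply: meval_eq => j; rewrite xs.
Qed.

End Dependence.

(** * Polynomials vanishing on all points of an algebraically closed field *)

Section ClosedField.
Variable k : closedFieldType.

(** The polynomial p + 1 takes only the value 1, so it has no root and is constant. *)
Lemma poly_eq0_pointwise (p : {poly k}) : (forall t, p.[t] = 0) -> p = 0.
Proof.
move=> p0; have s1 : size (p + 1) = 1%N.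
  apply/eqP/negPn/negP => /closed_rootP[t]; rewrite /root hornerD p0 hornerC add0r.
  by rewrite oner_eq0.
have [c e] : exists c, p = c%:P.
  by have /eqP/size_poly1P[c _ e] := s1; exists (c - 1); rewrite polyCB -e addrK.
by have := p0 0; rewrite e hornerC => ->.
Qed.

Lemma poly_eq0_punctured (p : {poly k}) : (forall t, t != 0 -> p.[t] = 0) -> p = 0.
Proof.
move=> p0; have /eqP : 'X * p = 0.
  apply: poly_eq0_pointwise => t; rewrite hornerM hornerX.
  by have [->|/p0 ->] := eqVneq t 0; rewrite ?mul0r ?mulr0.
by rewrite mulf_eq0 polyX_eq0 => /eqP.
Qed.

Lemma mpoly2_eq0_punctured (P : {mpoly k[2]}) :
  (forall v, (v ord0, v ord_max) != (0, 0) -> P.@[v] = 0) -> P = 0.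
Proof.
(* Kronecker's substitution: u |-> (u, u ^ N) separates the monomials of P. *)
move=> P0; pose N := msize P.
pose w (a : 'X_{1..2}) := (a ord0 + N * a ord_max)%N.
pose c (i : 'I_2) : {poly k} := 'X^(if i == ord0 then 1 else N).
have monc a : mmap1 c a = 'X^(w a).
  rewrite /mmap1 big_ord_recl big_ord1 /c eqxx expr1 -exprM -exprD.
  by rewrite (_ : lift _ _ = ord_max) //; apply: val_inj.
have : along c P = 0.
  apply: poly_eq0_punctured => t t0; rewrite horner_along; apply: P0.
  by rewrite /c eqxx expr1 hornerX; apply: contraNneq t0 => -[->].
rewrite /along /mmap => along0; apply/mpolyP => a; rewrite mcoeff0.
have [aP|/memN_msupp_eq0 //] := boolP (a \in msupp P).
have := congr1 (fun p : {poly k} => p`_(w a)) along0.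
rewrite coef0 coef_sum (bigD1_seq a) //= big1_seq ?addr0.
  by rewrite monc mul_polyC coefZ coefXn eqxx mulr1.
move=> b /andP[ba bP]; rewrite monc mul_polyC coefZ coefXn.
case: eqP => [e|_]; last by rewrite mulr0.
have lt_N (d : 'X_{1..2}) i : d \in msupp P -> (d i < N)%N.
  move=> dP; apply: leq_ltn_trans (msize_mdeg_lt dP); rewrite mdegE (bigD1 i) //=.
  exact: leq_addr.
have e0 : a ord0 = b ord0.
  have := congr1 (modn^~ N) e; rewrite /w -![(N * _)%N]mulnC ![(_ + _ * N)%N]addnC !modnMDl.
  by rewrite !modn_small // lt_N.
have e1 : a ord_max = b ord_max.
  move: e; rewrite /w e0 => /addnI/eqP.
  by rewrite eqn_pmul2l ?(leq_ltn_trans _ (lt_N a ord0 aP)) // => /eqP.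
case/eqP: ba; apply/mnmP => i.
by have [->|->] := ord2_cases i.
Qed.

End ClosedField.

(** * Tangent spaces *)

Section TangentSpaces.
Variables (k : fieldType) (m : nat).
Implicit Types (X : set 'cV[k]_m) (x v u : 'cV[k]_m) (f g : {mpoly k[m]}).

Definition dirder x v f : k := \sum_(i < m) mevalc (f^`M(i)) x * v i 0.

Lemma dirderB x v f g : dirder x v (f - g) = dirder x v f - dirder x v g.
Proof.
rewrite /dirder -sumrB; apply: eq_bigr => i _.
by rewrite mderivB /mevalc mevalB mulrBl.
Qed.

Lemma dirderM x v f g :
  dirder x v (f * g) = dirder x v f * mevalc g x + mevalc f x * dirder x v g.
Proof.
rewrite /dirder mulr_suml mulr_sumr -big_split; apply: eq_bigr => i _.
by rewrite mderivM /mevalc mevalD !mevalM mulrDl mulrAC mulrA.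
Qed.

Lemma dirderXU x v i : dirder x v 'X_i = v i 0.
Proof.
rewrite /dirder (bigD1 i) //= big1 ?addr0 => [|j ji].
  by rewrite mderivXU eqxx /mevalc meval1 mul1r.
by rewrite mderivXU eq_sym (negbTE ji) /mevalc meval0 mul0r.
Qed.

Lemma mevalcXU x i : mevalc 'X_i x = x i 0.
Proof. exact: mevalXU. Qed.

Lemma mevalcXn x f e : mevalc (f ^+ e) x = mevalc f x ^+ e.
Proof. by rewrite /mevalc rmorphXn. Qed.

Lemma dirderXn x v f e :
  dirder x v (f ^+ e) = e%:R * mevalc f x ^+ e.-1 * dirder x v f.
Proof.
elim: e => [|e IH].
  rewrite expr0 mul0r mul0r /dirder big1 // => i _.
  by rewrite -mpolyC1 mderivC /mevalc meval0 mul0r.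
rewrite exprS dirderM IH mevalcXn; case: e {IH} => [|e].
  by rewrite !mul0r mulr0 addr0 mulr1 !mul1r.
rewrite /= -[in RHS]natr1 !mulrDl mul1r addrC; congr (_ + _); last exact: mulrC.
by rewrite exprS !mulrA [mevalc f x * _]mulrC.
Qed.

Lemma tangentP X x v f : tangent X x v -> vanishes_on X f -> dirder x v f = 0.
Proof. exact. Qed.

Lemma tangentD X x u v : tangent X x u -> tangent X x v -> tangent X x (u + v).
Proof.
move=> Tu Tv f f0; transitivity (dirder x u f + dirder x v f).
  by rewrite /dirder -big_split; apply: eq_bigr => i _; rewrite mxE mulrDr.
by rewrite !(tangentP _ f0) ?addr0.
Qed.

Lemma tangentZ X x a v : tangent X x v -> tangent X x (a *: v).
Proof.
move=> Tv f f0; transitivity (a * dirder x v f).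
  by rewrite /dirder mulr_sumr; apply: eq_bigr => i _; rewrite mxE mulrCA.
by rewrite (tangentP Tv f0) mulr0.
Qed.

Lemma smooth_point_of_tangent X x u v : X x -> has_dim X 1 ->
  (forall a b, a *: u + b *: v = 0 -> a = 0 /\ b = 0) ->
  (forall w, tangent X x w <-> exists a b, w = a *: u + b *: v) ->
  smooth_point X x.
Proof.
move=> Xx dimX indep T; split=> //; exists 1%N => //.
have uv_free : free [:: u; v].
  apply/freeP => c; rewrite !big_ord_recl big_ord0 addr0 /= => /indep[c0 c1] i.
  case: i => [[|[|//]] hi]; [rewrite -[RHS]c0|rewrite -[RHS]c1]; congr (c _); exact: val_inj.
exists <<[:: u; v]>>%VS; last by apply/eqP; have := uv_free; rewrite /free.
apply/seteqP; split=> w /=; last first.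
  rewrite span_cons span_seq1 => /memv_addP[_ /vlineP[a ->] [_ /vlineP[b ->] ->]].
  by apply/T; exists a, b.
by move=> /T[a [b ->]]; rewrite rpredD // rpredZ // memv_span // !inE eqxx ?orbT.
Qed.

Lemma not_smooth_point_of_tangent X x u v w :
  (forall r, has_dim X r -> r = 1%N) ->
  tangent X x u -> tangent X x v -> tangent X x w ->
  (forall a b c, a *: u + b *: v + c *: w = 0 -> [/\ a = 0, b = 0 & c = 0]) ->
  ~ smooth_point X x.
Proof.
move=> dimX Tu Tv Tw indep [_ [r /dimX -> [U TU dimU]]].
have uvw_free : free [:: u; v; w].
  apply/freeP => c; rewrite !big_ord_recl big_ord0 addr0 /= addrA => /indep[c0 c1 c2] i.
  case: i => [[|[|[|//]]] hi]; [rewrite -[RHS]c0|rewrite -[RHS]c1|rewrite -[RHS]c2];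
    congr (c _); exact: val_inj.
have : (<<[:: u; v; w]>> <= U)%VS.
  apply/span_subvP => z; rewrite !inE => /or3P[]/eqP->.
  - by have : tangent X x u by []; rewrite TU.
  - by have : tangent X x v by []; rewrite TU.
  - by have : tangent X x w by []; rewrite TU.
by move=> /dimvS; rewrite dimU; move: uvw_free; rewrite /free => /eqP ->.
Qed.

End TangentSpaces.

Section CurvesInSets.
Variables (k : closedFieldType) (m : nat).
Implicit Types (X : set 'cV[k]_m) (c : 'I_m -> {poly k}).

Lemma along_vanishing X c f :
  (forall t, t != 0 -> X (\col_i (c i).[t])) -> vanishes_on X f -> along c f = 0.
Proof.
move=> Xc f0; apply: poly_eq0_punctured => t /Xc /f0 <-.
by rewrite horner_along; apply: meval_eq => i; rewrite mxE.
Qed.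

(** An equation of X composed with the curve is the zero polynomial, so its derivative vanishes at
    every t0. The value t0 = 0 is allowed although the curve is only known to lie in X for t
    nonzero; this serves the end points. *)
Lemma tangent_along X c t0 :
  (forall t, t != 0 -> X (\col_i (c i).[t])) ->
  tangent X (\col_i (c i).[t0]) (\col_i (c i)^`().[t0]).
Proof.
move=> Xc f /(along_vanishing Xc) f0.
have := congr1 (fun p : {poly k} => p^`().[t0]) f0.
rewrite deriv0 horner0 deriv_along horner_sum => e; rewrite -[RHS]e.
apply: eq_bigr => i _; rewrite mxE hornerM horner_along; congr (_ * _).
by apply: meval_eq => j; rewrite mxE.
Qed.

End CurvesInSets.

(** * Monomial curves *)

Section MonomialCurves.
Variable k : closedFieldType.
Implicit Types (a : 'I_4 -> nat) (D : nat).

(** The exponents are an arbitrary function of the coordinate, not an increasing list, so permuting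
    the coordinates and exchanging s with t stay within the same kind of curve. *)
Definition mono_pt a D (s t : k) : 'cV[k]_4 := \col_l (s ^+ (D - a l) * t ^+ a l).

Definition mono a D : set 'cV[k]_4 := param_image (mono_pt a D).

Definition mono_exponents a D :=
  [/\ (0 < D)%N, forall l, (a l <= D)%N, exists o, a o = 0%N & exists w, a w = D].

Definition torus a (u : k) : 'M[k]_4 := diag_mx (\row_l u ^+ a l).

Lemma mono_rev a D : (forall l, (a l <= D)%N) -> mono a D = mono (fun l => D - a l)%N D.
Proof.
move=> aD.
have e s t : mono_pt a D s t = mono_pt (fun l => D - a l)%N D t s.
  by apply/colP => l; rewrite !mxE subKn // mulrC.
apply/seteqP; split=> x /= [s [t [st p]]]; exists t, s.
  by rewrite -e; split=> //; apply: contraNneq st => -[-> ->].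
by rewrite e; split=> //; apply: contraNneq st => -[-> ->].
Qed.

Lemma exists_root n (c : k) : (0 < n)%N -> exists r, r ^+ n = c.
Proof.
move=> n_gt0; have /closed_rootP[r] : size ('X^n - c%:P) != 1%N.
  by rewrite size_XnsubC // eqSS -lt0n.
by rewrite /root !hornerE subr_eq0 => /eqP; exists r.
Qed.

Variables (a : 'I_4 -> nat) (D : nat).
Hypothesis aP : mono_exponents a D.
Local Notation X := (mono a D).

(** The parametrisation is homogeneous of degree D, so the free scalar in the definition of the cone
    is absorbed into (s, t) by a D-th root. *)
Lemma mono_ptP x : X x <-> exists s t, (s, t) != (0, 0) /\ x = mono_pt a D s t.
Proof.
have [D_gt0 aD [o ao] [w aw]] := aP.
split=> [[s [t [st [x0 [c e]]]]]|[s [t [st ->]]]]; last first.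
  exists s, t; split=> //; split; last by exists 1; rewrite scale1r.
  have [s0|s0] := eqVneq s 0.
    have t0 : t != 0 by apply: contraNneq st => ->; rewrite s0.
    apply/eqP => /colP/(_ w); rewrite !mxE aw subnn expr0 mul1r => /eqP.
    by rewrite expf_eq0 (negbTE t0) andbF.
  apply/eqP => /colP/(_ o); rewrite !mxE ao subn0 expr0 mulr1 => /eqP.
  by rewrite expf_eq0 (negbTE s0) andbF.
have [r rD] := exists_root c D_gt0.
have r0 : r != 0.
  apply: contraNneq x0 => r0; move: e; rewrite -rD r0 expr0n eqn0Ngt D_gt0 scale0r.
  by move->.
exists (r * s), (r * t); split.
  by apply: contraNneq st => -[/eqP + /eqP]; rewrite !mulf_eq0 (negbTE r0) => /eqP -> /eqP ->.
apply/colP => l; rewrite e -rD !mxE !exprMn.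
by rewrite -[X in r ^+ X * _ = _](subnK (aD l)) exprD mulrACA.
Qed.

Lemma mono_mono_pt s t : (s, t) != (0, 0) -> X (mono_pt a D s t).
Proof. by move=> st; apply/mono_ptP; exists s, t. Qed.

Lemma mono_dependent n (f : n.-tuple {mpoly k[4]}) : (2 < n)%N -> ~ alg_indep_on X f.
Proof.
apply: (@parametrized_dependent _ _ _ _
  [tuple 'X_ord0 ^+ (D - a i) * 'X_ord_max ^+ a i | i < 4]).
move=> x /mono_ptP[s [t [_ ->]]]; exists (fun i : 'I_2 => if i == ord0 then s else t) => i.
by rewrite tnth_mktuple mxE mevalM !rmorphXn /= !mevalXU eqxx.
Qed.

(** Two parameters bound the dimension from above. From below, the coordinates with exponents 0 and
    D are s^D and t^D, which take all pairs of values other than (0, 0), hence are algebraically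
    independent. *)
Lemma mono_has_dim : has_dim X 1.
Proof.
have [D_gt0 aD [o ao] [w aw]] := aP; split; last first.
  by move=> [f]; exact: mono_dependent.
exists [tuple 'X_o; 'X_w] => P P0; apply: mpoly2_eq0_punctured => v v0.
have [s es] := exists_root (v ord0) D_gt0; have [t et] := exists_root (v ord_max) D_gt0.
have st : (s, t) != (0, 0).
  by apply: contraNneq v0 => -[s0 t0]; rewrite -es -et s0 t0 expr0n eqn0Ngt D_gt0.
rewrite -(P0 _ (mono_mono_pt st)) /mevalc comp_mpoly_meval; apply: meval_eq => i.
case: i => [[|[|//]] hi]; rewrite (tnth_nth 0) /= mevalXU mxE ?ao ?aw ?subn0 ?subnn.
  by rewrite mulr1 es; congr v; apply: val_inj.
by rewrite mul1r et; congr v; apply: val_inj.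
Qed.

Lemma mono_dim_uniq r : has_dim X r -> r = 1%N.
Proof.
have [_ no2] := mono_has_dim; have [[f indf] _] := mono_has_dim.
case: r => [|[|r]] //.
  by move=> [_ no]; case: no; exists f.
by move=> [[g indg] _]; case: (mono_dependent (f := g)).
Qed.

Lemma mono_scale c x : c != 0 -> X x -> X (c *: x).
Proof.
move=> c0 [s [t [st [x0 [b e]]]]]; exists s, t; split=> //; split.
  by rewrite scaler_eq0 (negbTE c0).
by exists (c * b); rewrite e scalerA.
Qed.

Lemma mono_image_scalar c : c != 0 -> proj_image c%:M X = X.
Proof.
move=> c0; apply/seteqP; split=> x /=.
  by move=> [y Xy <-]; rewrite mul_scalar_mx; exact: mono_scale.
move=> Xx; exists (c^-1 *: x); first by apply: mono_scale; rewrite ?invr_eq0.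
by rewrite mul_scalar_mx scalerA divff // scale1r.
Qed.

Lemma torusE u (x : 'cV[k]_4) l : (torus a u *m x) l 0 = u ^+ a l * x l 0.
Proof. by rewrite /torus mul_diag_mx !mxE. Qed.

Lemma mono_torus u x : u != 0 -> X x -> X (torus a u *m x).
Proof.
move=> u0 /mono_ptP[s [t [st ->]]]; apply/mono_ptP; exists s, (u * t); split.
  apply: contraNneq st => -[-> /eqP]; rewrite mulf_eq0 (negbTE u0) => /eqP ->.
  by [].
by apply/colP => l; rewrite torusE !mxE exprMn mulrCA.
Qed.

Lemma torusV u : u != 0 -> torus a u^-1 *m torus a u = 1%:M.
Proof.
move=> u0; apply/matrixP => i j; rewrite /torus mul_diag_mx !mxE exprVn.
have [->|_] := eqVneq i j; last by rewrite !mulr0n mulr0.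
by rewrite !mulr1n mulVf // expf_neq0.
Qed.

Lemma torus_unit u : u != 0 -> torus a u \in unitmx.
Proof. by move=> /torusV/mulmx1_unit[]. Qed.

Lemma invmx_torus u : u != 0 -> invmx (torus a u) = torus a u^-1.
Proof.
move=> u0; rewrite -[RHS]mulmx1 -(mulmxV (torus_unit u0)) mulmxA torusV //.
by rewrite mul1mx.
Qed.

Lemma mono_image_torus u : u != 0 -> proj_image (torus a u) X = X.
Proof.
move=> u0; apply/seteqP; split=> x /=; first by move=> [y Xy <-]; exact: mono_torus.
move=> Xx; exists (torus a u^-1 *m x); first by apply: mono_torus; rewrite ?invr_eq0.
by rewrite -invmx_torus // mulKVmx // torus_unit.
Qed.

(** These are the torus orbits on the curve: the fixed points t = 0 and s = 0, and the orbit of (1,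
    1, 1, 1). *)
Lemma mono_cases o w x :
  (forall l, l != o -> (0 < a l)%N) -> (forall l, l != w -> (a l < D)%N) ->
  X x ->
  exists2 c : k, c != 0 &
    [\/ x = c *: delta_mx o 0, x = c *: delta_mx w 0 |
        exists2 u : k, u != 0 & x = c *: (torus a u *m const_mx 1)].
Proof.
have [D_gt0 aD [o' ao'] [w' aw']] := aP.
move=> a_gt0 a_ltD /mono_ptP[s [t [st ->]]].
have ao : a o = 0%N by have [<-//|/a_gt0] := eqVneq o' o; rewrite ao'.
have aw : a w = D by have [<-//|/a_ltD] := eqVneq w' w; rewrite aw' ltnn.
have [t0|t0] := eqVneq t 0.
  have s0 : s != 0 by apply: contraNneq st => ->; rewrite t0.
  exists (s ^+ D); first by rewrite expf_neq0.
  apply: Or31; apply/colP => l; rewrite !mxE t0 eqxx andbT expr0n.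
  have [->|lo] := eqVneq l o; first by rewrite ao subn0.
  by rewrite eqn0Ngt a_gt0 // mulr0 mulr0.
have [s0|s0] := eqVneq s 0.
  exists (t ^+ D); first by rewrite expf_neq0.
  apply: Or32; apply/colP => l; rewrite !mxE s0 eqxx andbT expr0n subn_eq0.
  have [->|lw] := eqVneq l w; first by rewrite aw leqnn mul1r mulr1.
  by rewrite leqNgt a_ltD // mul0r mulr0.
exists (s ^+ D); first by rewrite expf_neq0.
apply: Or33; exists (t / s); first by rewrite mulf_neq0 ?invr_eq0.
apply/colP => l; rewrite [RHS]mxE torusE !mxE mulr1 exprMn mulrCA mulrC exprVn.
by congr (_ * _); rewrite -[D in RHS](subnK (aD l)) exprD mulfK // expf_neq0.
Qed.

End MonomialCurves.

Lemma uniq4_cover (o i j w l : 'I_4) : uniq [:: o; i; j; w] ->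
  [\/ l = o, l = i, l = j | l = w].
Proof.
move=> u; have : l \in [:: o; i; j; w].
  have [||_ ->] := uniq_min_size u (s2 := enum 'I_4); rewrite ?mem_enum //.
    by move=> x _; rewrite mem_enum.
  by rewrite size_enum_ord.
by rewrite !inE => /or4P[]/eqP; [apply: Or41|apply: Or42|apply: Or43|apply: Or44].
Qed.

Lemma muln_leq_lt_eq0 n x y : (n * x <= y)%N -> (y < x)%N -> n = 0%N.
Proof. by case: n => // n; rewrite mulSn => h; lia. Qed.

(** * Tangent spaces of monomial curves at the unit point and at the ends *)

Section MonomialTangents.
Variables (k : closedFieldType) (a : 'I_4 -> nat) (D : nat).
Hypothesis aP : mono_exponents a D.
Local Notation X := (@mono k a D).
Local Notation one := (const_mx 1 : 'cV[k]_4).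

Lemma mono_one : X one.
Proof.
apply/(mono_ptP aP); exists 1, 1; split; first by apply/eqP => -[/eqP]; rewrite oner_eq0.
by apply/colP => l; rewrite !mxE !expr1n mulr1.
Qed.

(** The cone contains the punctured line through x, whose velocity is x. *)
Lemma tangent_mono_euler x : X x -> tangent X x x.
Proof.
move=> Xx; have := @tangent_along k 4 X (fun l => x l 0 *: 'X) 1.
rewrite (_ : \col_i _ = x); last by apply/colP => l; rewrite mxE !hornerE ?mulr1.
rewrite (_ : \col_i _ = x); last by apply/colP => l; rewrite mxE derivZ derivX !hornerE ?mulr1.
apply=> t t0; rewrite (_ : \col_i _ = t *: x); first exact: mono_scale.
by apply/colP => l; rewrite !mxE !hornerE mulrC.
Qed.

Lemma tangent_mono_weights : tangent X one (\col_l (a l)%:R).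
Proof.
have := @tangent_along k 4 X (fun l => 'X^(a l)) 1.
rewrite (_ : \col_i _ = one); last first.
  by apply/colP => l; rewrite !mxE hornerXn expr1n.
rewrite (_ : \col_i _ = \col_l (a l)%:R); last first.
  by apply/colP => l; rewrite !mxE derivXn hornerMn hornerXn expr1n.
apply=> t t0; rewrite (_ : \col_i _ = torus a t *m one); last first.
  by apply/colP => l; rewrite torusE !mxE hornerXn mulr1.
by apply: mono_torus => //; exact: mono_one.
Qed.

Lemma mono_binomial (f g : {mpoly k[4]}) :
  (forall s t, mevalc f (mono_pt a D s t) = mevalc g (mono_pt a D s t)) ->
  vanishes_on X (f - g).
Proof.
move=> fg x /(mono_ptP aP)[s [t [_ ->]]].
by rewrite /mevalc mevalB -!/(mevalc _ _) fg subrr.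
Qed.

Lemma truncated_exchange e r : (e <= D)%N -> (r <= D)%N ->
  ((D - e) * r + D * e = (D - r) * e + D * r)%N.
Proof.
move=> eD rD; have := leq_mul eD (leqnn r); have := leq_mul rD (leqnn e).
by rewrite !mulnBl [(r * e)%N]mulnC; lia.
Qed.

Section UnitPoint.
Variables (o i j w : 'I_4) (r : nat).
Hypotheses (oijw : uniq [:: o; i; j; w]) (ao : a o = 0%N) (aj : a j = (a i + r)%N).
Hypotheses (aw0 : (a w)%:R = 0 :> k) (r0 : r%:R = 0 :> k) (ai0 : (a i)%:R != 0 :> k).

(** Two binomials vanishing on the curve have differentials a_i (v_w - v_o) and a_i (v_i - v_j) at
    the unit point, because a_w and r are zero in k. Conversely the unit vector and the vector of
    weights are tangent and span the solutions. *)
Lemma tangent_mono_one v : tangent X one v <-> v o 0 = v w 0 /\ v i 0 = v j 0.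
Proof.
have [D_gt0 aD _ _] := aP.
have pt l s t : mevalc 'X_l (mono_pt a D s t) = s ^+ (D - a l) * t ^+ a l :> k.
  by rewrite mevalcXU mxE.
have mM f g x : mevalc (f * g) x = mevalc f x * mevalc g x :> k by rewrite /mevalc mevalM.
have at1 l : mevalc 'X_l one = 1 by rewrite mevalcXU mxE.
split=> [Tv|[vow vij]].
  have cancel_ai b c : (a i)%:R * b - (a i)%:R * c = 0 -> b = c :> k.
    by move=> /eqP; rewrite -mulrBr mulf_eq0 (negbTE ai0) subr_eq0 => /eqP.
  split; apply: cancel_ai.
    have : vanishes_on X ('X_w ^+ a i * 'X_o ^+ a w - 'X_i ^+ a w * 'X_o ^+ a i).
      apply: mono_binomial => s t.
      rewrite !mM !mevalcXn !pt ao !subn0 expr0 mulr1 !exprMn -!exprM.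
      rewrite mulrAC -exprD [RHS]mulrAC -exprD truncated_exchange //.
      by rewrite [(a i * a w)%N]mulnC.
    move=> /(tangentP Tv).
    rewrite dirderB !dirderM !dirderXn !dirderXU !mevalcXn !at1 !expr1n aw0.
    rewrite !mul0r !mulr1 !mul1r !addr0 add0r => /eqP; rewrite subr_eq0 => /eqP ->.
    by rewrite subrr.
  have : vanishes_on X ('X_i ^+ (r + a i) - 'X_j ^+ a i * 'X_o ^+ r).
    apply: mono_binomial => s t.
    rewrite !mM !mevalcXn !pt ao !subn0 expr0 mulr1 !exprMn -!exprM aj.
    rewrite [RHS]mulrAC -exprD.
    rewrite (_ : (D - (a i + r)) * a i + D * r = (D - a i) * (r + a i))%N.
      by rewrite [(r + _)%N]addnC [(a i * _)%N]mulnC.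
    have [z ->] : exists z, D = (a i + (r + z))%N.
      by exists (D - a j)%N; rewrite addnA -aj subnKC.
    by rewrite addKn addnA addKn !mulnDl !mulnDr; lia.
  move=> /(tangentP Tv).
  rewrite dirderB !dirderM !dirderXn !dirderXU !mevalcXn !at1 !expr1n natrD r0.
  by rewrite !mul0r !mulr1 !mul1r !addr0 !add0r.
(* The weight vector is zero at o and w and takes the value a_i at both i and j, so this is the
   coefficient it must carry. *)
pose c := (v i 0 - v o 0) / (a i)%:R.
rewrite (_ : v = v o 0 *: one + c *: \col_l (a l)%:R); last first.
  apply/colP => l; rewrite !mxE mulr1.
  have ci : c * (a i)%:R = v i 0 - v o 0 by rewrite /c mulfVK.
  case: (uniq4_cover l oijw) => ->.
  - by rewrite ao mulr0 addr0.
  - by rewrite ci addrC subrK.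
  - by rewrite aj natrD r0 addr0 ci addrC subrK vij.
  - by rewrite aw0 mulr0 addr0.
apply: tangentD; apply: tangentZ; last exact: tangent_mono_weights.
by apply: tangent_mono_euler; exact: mono_one.
Qed.

End UnitPoint.

Section EndPoint.
Variable o : 'I_4.
Hypotheses (ao : a o = 0%N) (a_gt0 : forall l, l != o -> (0 < a l)%N).

Lemma mono_end : X (delta_mx o 0).
Proof.
have [D_gt0 aD _ _] := aP.
apply/(mono_ptP aP); exists 1, 0; split; first by apply/eqP => -[/eqP]; rewrite oner_eq0.
apply/colP => l; rewrite !mxE expr1n mul1r expr0n eqxx andbT.
have [->|/a_gt0] := eqVneq l o; first by rewrite ao.
by rewrite lt0n => /negbTE ->.
Qed.

Lemma mono_curve_pt t : t != 0 -> X (\col_l ('X^(a l)).[t]).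
Proof.
move=> t0; rewrite (_ : \col_l _ = torus a t *m one).
  by apply: mono_torus => //; exact: mono_one.
by apply/colP => l; rewrite torusE !mxE hornerXn mulr1.
Qed.

(** With x_c a local parameter, the equation x_l x_o^(a_l - 1) = x_c^(a_l) has differential v_l at
    the end point, as a_l > 1. Conversely e_c is the velocity of the curve at t = 0. *)
Lemma tangent_mono_end c v : c != o -> a c = 1%N ->
  (forall l, l != o -> l != c -> (1 < a l)%N) ->
  tangent X (delta_mx o 0) v <-> (forall l, l != o -> l != c -> v l 0 = 0).
Proof.
move=> co ac a_gt1; have [D_gt0 aD _ _] := aP.
have mM f g x : mevalc (f * g) x = mevalc f x * mevalc g x :> k by rewrite /mevalc mevalM.
have ate l : mevalc 'X_l (delta_mx o 0) = (l == o)%:R :> k by rewrite mevalcXU mxE andbT.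
split=> [Tv l lo lc|v0].
  have al_gt1 := a_gt1 l lo lc.
  have pal : ((a l).-1 == 0)%N = false by case: (a l) al_gt1 => [|[|]].
  have : vanishes_on X ('X_l * 'X_o ^+ (a l).-1 - 'X_c ^+ a l).
    apply: mono_binomial => s t.
    rewrite mM !mevalcXn !mevalcXU !mxE ao ac subn0 expr0 mulr1 expr1 exprMn -!exprM.
    rewrite mulrAC -exprD; congr (_ ^+ _ * _).
    by have := aD l; case: (a l) al_gt1 => // n _ nD; rewrite mulnBl mul1n !mulnS; lia.
  move=> /(tangentP Tv).
  rewrite dirderB dirderM !dirderXn !dirderXU mevalcXn !ate eqxx (negbTE lo) (negbTE co).
  by rewrite expr1n mul0r mulr1 addr0 expr0n pal mulr0 mul0r subr0.
rewrite (_ : v = v o 0 *: delta_mx o 0 + v c 0 *: delta_mx c 0); last first.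
  apply/colP => l; rewrite !mxE !andbT.
  have [->|lo] := eqVneq l o; first by rewrite eq_sym (negbTE co) mulr1 mulr0 addr0.
  have [->|lc] := eqVneq l c; first by rewrite mulr0 add0r mulr1.
  by rewrite !mulr0 addr0 v0.
apply: tangentD; apply: tangentZ; first by apply: tangent_mono_euler; exact: mono_end.
have := @tangent_along k 4 X (fun l => 'X^(a l)) 0 mono_curve_pt.
rewrite (_ : \col_i _ = delta_mx o 0); last first.
  apply/colP => l; rewrite !mxE hornerXn expr0n andbT.
  by have [->|/a_gt0] := eqVneq l o; rewrite ?ao // lt0n => /negbTE ->.
rewrite (_ : \col_i _ = delta_mx c 0) //.
apply/colP => l; rewrite !mxE derivXn hornerMn hornerXn expr0n andbT.
have [->|lc] := eqVneq l c; first by rewrite ac.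
have [->|lo] := eqVneq l o; first by rewrite ao.
by have := a_gt1 l lo lc; case: (a l) => [|[|n]] //; rewrite mul0rn.
Qed.

Lemma smooth_mono_end c : c != o -> a c = 1%N ->
  (forall l, l != o -> l != c -> (1 < a l)%N) -> smooth_point X (delta_mx o 0).
Proof.
move=> co ac a_gt1.
apply: (smooth_point_of_tangent (u := delta_mx o 0) (v := delta_mx c 0)).
- exact: mono_end.
- exact: mono_has_dim.
- move=> b b' /colP e; move: (e o) (e c); rewrite !mxE !eqxx (negbTE co) [o == c]eq_sym.
  by rewrite (negbTE co) !mulr1 !mulr0 addr0 add0r.
move=> v; rewrite (tangent_mono_end _ co ac a_gt1); split=> [v0|[b [b' ->]] l lo lc]; last first.
  by rewrite !mxE (negbTE lo) (negbTE lc) !mulr0 addr0.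
exists (v o 0), (v c 0); apply/colP => l; rewrite !mxE !andbT.
have [->|lo] := eqVneq l o; first by rewrite eq_sym (negbTE co) mulr1 mulr0 addr0.
have [->|lc] := eqVneq l c; first by rewrite mulr0 add0r mulr1.
by rewrite !mulr0 addr0 v0.
Qed.

(* The coefficient of t ^ (a c) in f (t ^ a) is the c-th partial derivative at
   the end point as soon as a c is not a nontrivial sum of exponents. *)
Lemma tangent_mono_end_irreducible c : c != o ->
  (forall n : 'X_{1..4}, (\sum_l n l * a l = a c)%N ->
     n c = 1%N /\ forall l, l != o -> l != c -> n l = 0%N) ->
  tangent X (delta_mx o 0) (delta_mx c 0).
Proof.
move=> co irr f f0; rewrite (bigD1 c) //= big1 ?addr0 => [|l lc]; last first.
  by rewrite mxE (negbTE lc) mulr0.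
rewrite mxE !eqxx mulr1.
have := congr1 (fun p : {poly k} => p`_(a c)) (along_vanishing mono_curve_pt f0).
rewrite coef0 => e; rewrite -[RHS]e; clear e f0.
elim/mpolyind: f => [|b n f _ _ IH].
  by rewrite mderiv0 /along mmap0 coef0 /mevalc meval0.
rewrite mderivD mderivZ /along mmapD mmapZ coefD mul_polyC coefZ /mevalc mevalD mevalZ.
move: IH; rewrite /mevalc => ->; congr (_ * _ + _); rewrite mmapX /mmap1 mderivX mevalZ mevalX.
rewrite (eq_bigr (fun l => 'X^(n l * a l))) => [|l _]; last by rewrite -exprM mulnC.
rewrite -expr_sum coefXn; case: eqP => [/esym/irr[nc n0]|ne].
  rewrite nc mul1r big1 // => l _; rewrite mnmBE mnm1E mxE andbT.
  have [->|lo] := eqVneq l o; first by rewrite expr1n.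
  have [->|lc] := eqVneq l c; first by rewrite nc.
  by rewrite n0.
have [nc0|nc0] := eqVneq (n c) 0%N; first by rewrite nc0 mul0r.
set p := \prod_(l < 4) _; have [->|] := eqVneq p 0; first by rewrite mulr0.
move=> /prodf_neq0 n0; case: ne.
have {}n0 l : l != o -> (n l = (l == c))%N.
  move=> lo; have := n0 l isT; rewrite mnmBE mnm1E mxE (negbTE lo) /= expr0n.
  have [e _|_] := eqVneq (n l - (c == l))%N 0%N; last by rewrite /= eqxx.
  move: e; rewrite [c == l]eq_sym; have [->|_] := eqVneq l c => /=; last by lia.
  by move: nc0; lia.
rewrite (bigD1 c) //= (bigD1 o) /= 1?eq_sym // ao muln0 (n0 c co) eqxx mul1n big1 ?addn0 //.
by move=> l /andP[lc lo]; rewrite n0 // (negbTE lc).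
Qed.

(** The exponent a_c is the least positive one, and a_s cannot be composed from a_c and a_r, which
    are both multiples of a_c. Hence e_c and e_s are tangent besides e_o, one dimension too many. *)
Lemma not_smooth_mono_end c r s : uniq [:: o; c; r; s] ->
  (a c < a r)%N -> (a c < a s)%N -> (a c %| a r)%N -> ~~ (a c %| a s)%N ->
  ~ smooth_point X (delta_mx o 0).
Proof.
move=> u cr cs c_dvd_r c_ndvd_s.
have [/and3P[oc or os] cr' cs' rs] :
  [/\ [&& o != c, o != r & o != s], c != r, c != s & r != s].
  move: u; rewrite /= !inE !negb_or => /and4P[/and3P[-> -> ->] /andP[-> ->] -> _].
  by [].
have co : c != o by rewrite eq_sym.
have so : s != o by rewrite eq_sym.
have sum4 (n : 'X_{1..4}) : (\sum_l n l * a l = n c * a c + n r * a r + n s * a s)%N.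
  rewrite (bigD1 o) //= (bigD1 c) //= (bigD1 r) /= 1?eq_sym ?or 1?eq_sym ?cr' //.
  rewrite (bigD1 s) /= ?so ?[s == c]eq_sym ?cs' ?[s == r]eq_sym ?rs // big1 ?ao ?muln0 => [|l].
    by rewrite addn0 !addnA.
  move=> /andP[/andP[/andP[lo lc] lr] ls].
  by case: (uniq4_cover l u) lo lc lr ls => ->; rewrite ?eqxx.
have ac_gt0 := a_gt0 co.
apply: (not_smooth_point_of_tangent (mono_dim_uniq aP)
   (u := delta_mx o 0) (v := delta_mx c 0) (w := delta_mx s 0)).
- by apply: tangent_mono_euler; exact: mono_end.
- apply: tangent_mono_end_irreducible => // n; rewrite sum4 => e.
  have nr : n r = 0%N by apply: muln_leq_lt_eq0 cr; rewrite -e addnAC leq_addl.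
  have ns : n s = 0%N by apply: muln_leq_lt_eq0 cs; rewrite -e leq_addl.
  have nc : n c = 1%N.
    move: e; rewrite nr ns !mul0n !addn0 => /eqP.
    by rewrite -[X in _ == X]mul1n eqn_pmul2r // => /eqP.
  split=> // l lo lc; case: (uniq4_cover l u) lo lc => ->; rewrite ?eqxx //.
- apply: tangent_mono_end_irreducible => // n; rewrite sum4 => e.
  have ns : n s = 1%N.
    case ns : (n s) e => [|[|z]] // e; last first.
      have : (z.+2 * a s <= a s)%N by rewrite -{2}e leq_addl.
      by rewrite -{2}[a s]mul1n leq_pmul2r // (leq_trans _ cs).
    by case/negP: c_ndvd_s; rewrite -e mul0n addn0 dvdn_add ?dvdn_mull.
  move: e; rewrite ns mul1n => /(canRL (addnK _)); rewrite subnn => /eqP.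
  rewrite addn_eq0 !muln_eq0 !(gtn_eqF ac_gt0) (gtn_eqF (ltn_trans ac_gt0 cr)) !orbF.
  move=> /andP[/eqP nc /eqP nr]; split=> // l lo lc.
  by case: (uniq4_cover l u) lo lc => ->; rewrite ?eqxx.
- move=> x y z /colP e; move: (e o) (e c) (e s); rewrite !mxE !eqxx.
  rewrite (negbTE oc) (negbTE os) (negbTE co) (negbTE so) (negbTE cs') [s == c]eq_sym.
  by rewrite (negbTE cs') !mulr1 !mulr0 !addr0 !add0r.
Qed.


End EndPoint.

End MonomialTangents.

(** * Non-reflexivity *)

Section ScaledPoints.
Variables (k : closedFieldType) (a : 'I_4 -> nat) (D : nat).
Hypothesis aP : mono_exponents a D.
Local Notation X := (@mono k a D).
Local Notation one := (const_mx 1 : 'cV[k]_4).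

Lemma tangent_mono_scale c x v : c != 0 -> tangent X (c *: x) v <-> tangent X x v.
Proof.
move=> c0; have uc : (c%:M : 'M[k]_4) \in unitmx by rewrite unitmxE det_scalar unitfE expf_neq0.
have := tangent_imageE X x (c^-1 *: v) uc.
rewrite mono_image_scalar // !mul_scalar_mx scalerA divff // scale1r => ->.
split=> [/(tangentZ c)|]; last exact: tangentZ.
by rewrite scalerA divff // scale1r.
Qed.

Lemma smooth_mono_scale c x : c != 0 -> smooth_point X (c *: x) <-> smooth_point X x.
Proof.
move=> c0; have uc : (c%:M : 'M[k]_4) \in unitmx by rewrite unitmxE det_scalar unitfE expf_neq0.
by have := smooth_point_imageE X x uc; rewrite mono_image_scalar // mul_scalar_mx.
Qed.

Lemma smooth_mono_torus u x : u != 0 -> smooth_point X (torus a u *m x) <-> smooth_point X x.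
Proof.
move=> u0; have := smooth_point_imageE X x (torus_unit a u0).
by rewrite mono_image_torus.
Qed.

Lemma tangent_mono_torus u x v : u != 0 ->
  tangent X (torus a u *m x) (torus a u *m v) <-> tangent X x v.
Proof.
move=> u0; have := tangent_imageE X x v (torus_unit a u0).
by rewrite mono_image_torus.
Qed.

End ScaledPoints.

Section Nonreflexive.
Variables (k : closedFieldType) (a : 'I_4 -> nat) (D : nat).
Hypothesis aP : mono_exponents a D.
Local Notation X := (@mono k a D).
Local Notation one := (const_mx 1 : 'cV[k]_4).
Variables (o i j w top : 'I_4) (q b c : nat).
Hypotheses (oijw : uniq [:: o; i; j; w]) (q_gt0 : (0 < q)%N) (q0 : q%:R = 0 :> k).
Hypotheses (ao : a o = 0%N) (aj : a j = (a i + q * b)%N) (aw : a w = (q * c)%N).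
Hypotheses (ai0 : (a i)%:R != 0 :> k) (c0 : c%:R != 0 :> k).
Hypotheses (a_gt0 : forall l, l != o -> (0 < a l)%N).
Hypotheses (a_ltD : forall l, l != top -> (a l < D)%N).

Let tangent_one v : tangent X one v <-> v o 0 = v w 0 /\ v i 0 = v j 0.
Proof.
by apply: (tangent_mono_one aP oijw ao aj _ _ ai0); rewrite ?aw ?natrM ?q0 ?mul0r.
Qed.

Let ne_oijw : [/\ [&& o != i, o != j & o != w], i != j, i != w & j != w].
Proof.
move: oijw; rewrite /= !inE !negb_or => /and4P[/and3P[-> -> ->] /andP[-> ->] -> _].
by [].
Qed.

Lemma smooth_mono_one : smooth_point X one.
Proof.
have [/and3P[oi oj _] ij iw jw] := ne_oijw.
apply: (smooth_point_of_tangent (u := one) (v := delta_mx i 0 + delta_mx j 0)).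
- exact: mono_one.
- exact: mono_has_dim.
- move=> s t /colP e; move: (e o) (e i); rewrite !mxE !eqxx (negbTE oi) (negbTE oj) /=.
  rewrite addr0 mulr0 addr0 mulr1 => ->; rewrite add0r.
  by rewrite (negbTE ij) addr0 mulr1 => ->.
move=> v; rewrite tangent_one; split=> [[vow vij]|[s [t ->]]]; last first.
  rewrite !mxE !eqxx (negbTE oi) (negbTE oj) (negbTE ij) [j == i]eq_sym (negbTE ij).
  by rewrite ![w == _]eq_sym (negbTE iw) (negbTE jw) !addr0 !add0r.
exists (v o 0), (v i 0 - v o 0); apply/colP => l; rewrite !mxE !andbT mulr1.
case: (uniq4_cover l oijw) => ->.
- by rewrite (negbTE oi) (negbTE oj) addr0 mulr0 addr0.
- by rewrite eqxx (negbTE ij) addr0 mulr1 addrC subrK.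
- by rewrite eqxx eq_sym (negbTE ij) add0r mulr1 addrC subrK.
- by rewrite ![w == _]eq_sym (negbTE iw) (negbTE jw) addr0 mulr0 addr0 vow.
Qed.

(* Over an ordinary point, the conormal space only depends on the scaled pairs
   (x_o, x_w) and (x_i, x_j); this matrix rescales both pairs. *)
Definition pair_scaling (s t : k) : 'M[k]_4 :=
  diag_mx (\row_l if (l == i) || (l == j) then t else s).

Hypothesis end_tangent : forall l s t v, l \in [:: o; top] ->
  smooth_point X (delta_mx l 0) -> tangent X (delta_mx l 0) v ->
  tangent X (delta_mx l 0) (pair_scaling s t *m v).

(** At the unit point the equations v_o = v_w and v_i = v_j survive a common scaling of each pair;
    the torus consists of diagonal matrices too, so this carries over to its orbit. The two end
    points are covered by [end_tangent]. *)
Lemma smooth_tangent_pair_scaling x s t v :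
  smooth_point X x -> tangent X x v -> tangent X x (pair_scaling s t *m v).
Proof.
move=> sx Tv; have [Xx _] := sx.
have [e e0 [ex|ex|[u u0 ex]]] := mono_cases aP a_gt0 a_ltD Xx; move: sx Tv; rewrite ex.
- rewrite !tangent_mono_scale // smooth_mono_scale //.
  by apply: end_tangent; rewrite !inE eqxx.
- rewrite !tangent_mono_scale // smooth_mono_scale //.
  by apply: end_tangent; rewrite !inE eqxx orbT.
rewrite !tangent_mono_scale // => _; rewrite -[v](mulKVmx (torus_unit a u0)).
move: (_ *m v) => {Xx ex x} {}v.
rewrite (_ : pair_scaling s t *m (torus a u *m v) = torus a u *m (pair_scaling s t *m v)).
  rewrite !tangent_mono_torus // !tangent_one /pair_scaling mul_diag_mx !mxE.
  have [/and3P[/negbTE-> /negbTE-> ow] ij iw jw] := ne_oijw.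
  by rewrite !eqxx orbT ![w == _]eq_sym (negbTE iw) (negbTE jw) => -[-> ->].
by rewrite !mulmxA /pair_scaling /torus !mulmx_diag; congr (diag_mx _ *m _);
  apply/rowP => l; rewrite !mxE mulrC.
Qed.

Definition dual_scaling (u : k) : 'M[k]_4 :=
  diag_mx (\row_l if l == o then u ^+ c else if l == i then u ^+ b else 1).

Lemma dual_scaling_unit u : u != 0 -> dual_scaling u \in unitmx.
Proof.
move=> u0; rewrite unitmxE det_diag unitfE; apply/prodf_neq0 => l _; rewrite mxE.
by do 2?case: ifP => _; rewrite ?expf_neq0 ?oner_eq0.
Qed.

(** The exponents c and b of [dual_scaling] are chosen with q c = a_w - a_o and q b = a_j - a_i:
    they make up the difference of weights within each pair. *)
Lemma dual_scaling_torus u :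
  dual_scaling (u ^+ q) *m torus a u = pair_scaling (u ^+ a w) (u ^+ a j).
Proof.
have [/and3P[oi oj ow] ij iw jw] := ne_oijw.
rewrite /dual_scaling /torus mulmx_diag; congr diag_mx; apply/rowP => l; rewrite !mxE.
case: (uniq4_cover l oijw) => ->.
- by rewrite eqxx (negbTE oi) (negbTE oj) ao mulr1 -exprM aw.
- by rewrite eq_sym (negbTE oi) eqxx -exprM -exprD aj addnC.
- by rewrite eq_sym (negbTE oj) eq_sym (negbTE ij) eqxx mul1r.
- by rewrite ![w == _]eq_sym (negbTE ow) (negbTE iw) (negbTE jw) mul1r.
Qed.

(** When the point moves by the torus at u, the hyperplane may be moved by a matrix depending on u^q
    only: the inseparability of the Gauss map. *)
Lemma conormal_mono_scaling u x h : u != 0 -> conormal X (x, h) ->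
  conormal X (torus a u *m x, dual_scaling (u ^+ q) *m h).
Proof.
move=> u0; apply: biclosure_image; first exact: torus_unit.
  by rewrite dual_scaling_unit ?expf_neq0.
move=> y g [/= sy g0 Tg]; split=> /=; first by apply/smooth_mono_torus.
  by apply: mulmx_neq0; rewrite ?dual_scaling_unit ?expf_neq0.
move=> v Tv; rewrite trmx_mul tr_diag_mx -mulmxA.
(* Pulling v back by the torus gives a tangent vector at y, on which the combined matrix acts as a
   pair scaling and so stays tangent. *)
rewrite -(mulKVmx (torus_unit a u0) v) [_ *m (torus a u *m _)]mulmxA.
rewrite -/(dual_scaling (u ^+ q)) dual_scaling_torus; apply: Tg.
apply: smooth_tangent_pair_scaling => //.
by apply/(tangent_mono_torus aP y _ u0); rewrite mulKVmx // torus_unit.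
Qed.

(** Taking a q-th root of u turns the action through u^q into one by every nonzero u, which can then
    be differentiated with exponents c and b instead of q c and q b. *)
Lemma dual_mono_scaling u h : u != 0 ->
  dual_variety X h -> dual_variety X (dual_scaling u *m h).
Proof.
move=> u0 [x cx]; have [r e] := exists_root u q_gt0.
have r0 : r != 0 by apply: contraNneq u0 => r0; rewrite -e r0 expr0n gtn_eqF.
by exists (torus a r *m x); rewrite -e; exact: conormal_mono_scaling.
Qed.

(** The velocity at u = 1 of the orbit of h under [dual_scaling] has entries c h_o and b h_i and is
    tangent to the dual variety, hence is annihilated by x. The resulting bilinear equation passes
    to the closure. *)
Lemma conormal_dual_mono h x : conormal (dual_variety X) (h, x) ->
  c%:R * (h o 0 * x o 0) + b%:R * (h i 0 * x i 0) = 0.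
Proof.
have [/and3P[oi oj ow] ij iw jw] := ne_oijw.
pose f : {mpoly k[4 + 4]} :=
  c%:R *: ('X_(lshift 4 o) * 'X_(rshift 4 o)) + b%:R *: ('X_(lshift 4 i) * 'X_(rshift 4 i)).
have fE y g : mevalc f (col_mx y g) = c%:R * (y o 0 * g o 0) + b%:R * (y i 0 * g i 0).
  by rewrite /mevalc mevalD !mevalZ !mevalM !mevalXU !col_mxEu !col_mxEd.
move=> [/= h0 x0 cl]; rewrite -fE; apply: cl => -[g y] [/= [dg _] g0 Tg]; rewrite fE.
pose cv (l : 'I_4) : {poly k} :=
  if l == o then g o 0 *: 'X^c else if l == i then g i 0 *: 'X^b else (g l 0)%:P.
have : tangent (dual_variety X) g (\col_l (cv l)^`().[1]).
  rewrite [X in tangent _ X _](_ : g = \col_l (cv l).[1]); last first.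
    apply/colP => l; rewrite mxE /cv.
    by case: eqP => [->|_]; [|case: eqP => [->|_]]; rewrite !hornerE ?expr1n ?mulr1.
  apply: tangent_along => t t0.
  rewrite (_ : \col_l _ = dual_scaling t *m g); first exact: dual_mono_scaling.
  apply/colP => l; rewrite /dual_scaling mul_diag_mx !mxE /cv.
  by case: eqP => [->|_]; [|case: eqP => [->|_]]; rewrite !hornerE ?mul1r // mulrC.
move=> /Tg /matrixP/(_ 0 0); rewrite !mxE (bigD1 o) //= (bigD1 i) 1?eq_sym //= big1.
  rewrite !mxE /cv !eqxx [i == o]eq_sym (negbTE oi) addr0 !derivZ !derivXn.
  rewrite !hornerE !hornerMn !hornerXn !expr1n => /= e; rewrite -[RHS]e.
  by congr (_ + _); rewrite /= mulrC [RHS]mulrC mulrCA.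
move=> l /andP[lo li]; rewrite !mxE /cv (negbTE lo) (negbTE li) derivC.
by rewrite horner0 mulr0.
Qed.

Lemma mono_not_reflexive : ~ reflexive_variety X.
Proof.
have [/and3P[oi oj ow] ij iw jw] := ne_oijw.
pose h : 'cV[k]_4 := delta_mx w 0 - delta_mx o 0.
have ho : h o 0 = -1 by rewrite !mxE (negbTE ow) !eqxx /= sub0r.
have h0 : h != 0.
  by apply/eqP => /colP/(_ o); rewrite ho mxE => /eqP; rewrite oppr_eq0 oner_eq0.
have ch : conormal X (one, h).
  split=> //=; first by apply/eqP => /colP/(_ o); rewrite !mxE => /eqP; rewrite oner_eq0.
  move=> f f0; apply: (f0 (_, _)); split=> //=; first exact: smooth_mono_one.
  move=> v /tangent_one[vow _]; apply/matrixP => s t; rewrite !ord1 !mxE.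
  rewrite (bigD1 o) //= (bigD1 w) 1?eq_sym //= big1 => [|l /andP[lo lw]].
    rewrite !mxE !eqxx (negbTE ow) [w == o]eq_sym (negbTE ow) vow add0r subr0 addr0.
    by rewrite mulN1r mul1r addNr.
  by rewrite !mxE (negbTE lo) (negbTE lw) subr0 mul0r.
move=> /(congr1 (fun S => S (one, h))) /= e; move: ch; rewrite e => /conormal_dual_mono.
rewrite ho !mxE [i == o]eq_sym (negbTE oi) (negbTE iw) subr0 mul0r mulr0 addr0 mulr1.
by rewrite mulrN1 => /eqP; rewrite oppr_eq0 (negbTE c0).
Qed.

End Nonreflexive.

(** * Curves on the Hermitian surface *)

Section Images.
Variable k : closedFieldType.

Lemma param_image_mul (M : 'M[k]_4) (phi : k -> k -> 'cV[k]_4) : M \in unitmx ->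
  param_image (fun s t => M *m phi s t) = proj_image M (param_image phi).
Proof.
move=> uM; apply/seteqP; split=> [x [s [t [st [x0 [c e]]]]]|_ [x [s [t [st [x0 [c e]]]]] <-]].
  exists (c *: phi s t); last by rewrite e scalemxAr.
  exists s, t; split=> //; split; last by exists c.
  by apply: contraNneq x0 => e0; rewrite e scalemxAr e0 mulmx0.
exists s, t; split=> //; split; first exact: mulmx_neq0.
by exists c; rewrite e scalemxAr.
Qed.

Definition expo (d i j : nat) (l : 'I_4) : nat := nth 0%N [:: 0; i; j; d]%N l.

Lemma monomial_curveE (M : 'M[k]_4) d i j : M \in unitmx ->
  monomial_curve M d i j = proj_image M (mono (expo d i j) d).
Proof.
move=> uM; rewrite /monomial_curve -param_image_mul //; congr param_image.
apply/funext => s; apply/funext => t; congr (_ *m _); apply/colP => l; rewrite !mxE.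
by case: l => [[|[|[|[|]]]] //= hl]; rewrite ?subn0 ?subnn ?expr0 ?mulr1 ?mul1r.
Qed.

Lemma monomial_curve1 d i j :
  monomial_curve (1%:M : 'M[k]_4) d i j = mono (expo d i j) d.
Proof. by rewrite monomial_curveE ?unitmx1 // proj_image1. Qed.

Lemma mono_perm (s : 'S_4) a D :
  proj_image (perm_mx s) (mono a D) = mono (fun l => a (s l)) D :> set 'cV[k]_4.
Proof.
rewrite -param_image_mul ?unitmx_perm //; congr param_image.
apply/funext => u; apply/funext => v; rewrite -row_permE; apply/colP => l.
by rewrite !mxE.
Qed.

Lemma monomial_curve_swap (M : 'M[k]_4) d i j : M \in unitmx ->
  exists2 N, N \in unitmx & monomial_curve M d i j = monomial_curve N d j i.
Proof.
move=> uM; pose s : 'S_4 := tperm (inord 1) (inord 2).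
exists (M *m perm_mx s); first by rewrite unitmx_mul uM unitmx_perm.
rewrite !monomial_curveE ?unitmx_mul ?uM ?unitmx_perm // -proj_image_mul mono_perm.
congr proj_image; congr mono; apply/funext => l; rewrite /s /expo.
by case: tpermP => [->|->|]; rewrite ?inordK //; case: l => [[|[|[|[|]]]] //= hl] n1 n2;
  [case: n1|case: n2]; apply: val_inj; rewrite /= inordK.
Qed.

Lemma monomial_curve_rev (M : 'M[k]_4) d i j : M \in unitmx -> (i <= d)%N -> (j <= d)%N ->
  exists2 N, N \in unitmx & monomial_curve M d i j = monomial_curve N d (d - i) (d - j).
Proof.
move=> uM id jd; pose s : 'S_4 := tperm (inord 0) (inord 3).
exists (M *m perm_mx s); first by rewrite unitmx_mul uM unitmx_perm.
rewrite !monomial_curveE ?unitmx_mul ?uM ?unitmx_perm // -proj_image_mul mono_perm mono_rev.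
  congr proj_image; congr mono; apply/funext => l; rewrite /s /expo.
  case: tpermP => [->|->|]; rewrite ?inordK ?subn0 ?subnn //.
  by case: l => [[|[|[|[|]]]] //= hl] n1 n2; [case: n1|case: n2];
    apply: val_inj; rewrite /= inordK.
by case=> [[|[|[|[|]]]] //= hl].
Qed.

Lemma expo_mono_exponents d i j : (0 < d)%N -> (i <= d)%N -> (j <= d)%N ->
  mono_exponents (expo d i j) d.
Proof.
move=> d0 id jd; split=> //; first by case=> [[|[|[|[|]]]] //= hl].
  by exists ord0.
by exists ord_max.
Qed.

End Images.

(** * The Hermitian form pulled back to a monomial curve *)

Section HermitianSurface.
Variables (k : closedFieldType) (q : nat).
Hypotheses (q_gt0 : (0 < q)%N) (pchar_q : [pchar k].-nat q).
Local Notation frob := (map_mx (fun x : k => x ^+ q)).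

Lemma frob_mul m n r (M : 'M[k]_(m, n)) (N : 'M[k]_(n, r)) :
  frob (M *m N) = frob M *m frob N.
Proof.
have expq0 : (0 : k) ^+ q = 0 by rewrite expr0n gtn_eqF.
apply/matrixP => i j; rewrite !mxE.
rewrite (big_morph (fun x : k => x ^+ q) (fun x y => exprDn_pchar x y pchar_q) expq0).
by apply: eq_bigr => l _; rewrite !mxE exprMn.
Qed.

Lemma frob_unit n (M : 'M[k]_n) : M \in unitmx -> frob M \in unitmx.
Proof.
move=> uM; have /mulmx1_unit[] // : frob M *m frob (invmx M) = 1%:M.
rewrite -frob_mul mulmxV //; apply/matrixP => i j; rewrite !mxE.
by case: (i == j); rewrite ?expr1n // expr0n gtn_eqF.
Qed.

Variables (A M : 'M[k]_4) (d i j : nat).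
Hypotheses (uA : A \in unitmx) (uM : M \in unitmx).
Hypotheses (d_gt0 : (0 < d)%N) (id : (i <= d)%N) (jd : (j <= d)%N).
Hypothesis sub : monomial_curve M d i j `<=` hermitian_surface q A.

Let B := M^T *m A *m frob M.

Let B_unit : B \in unitmx.
Proof. by rewrite !unitmx_mul unitmx_tr uM uA frob_unit. Qed.

(** Evaluated at (1, t), the pulled back form is a polynomial in t that vanishes identically;
    without a collision the exponent of the pair (l, m) occurs once, so its coefficient is the entry
    of [B] alone. *)
Lemma hermitian_form_coef (l m : 'I_4) :
  (forall l' m', ~ collision [:: 0; i; j; d]%N q l m l' m') -> B l m = 0.
Proof.
move=> no_collision.
pose w (u : 'I_4 * 'I_4) := (expo d i j u.1 + q * expo d i j u.2)%N.
pose p : {poly k} := \sum_u B u.1 u.2 *: 'X^(w u).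
have p0 : p = 0.
  apply: poly_eq0_pointwise => t.
  have aP := expo_mono_exponents d_gt0 id jd.
  have /sub[_] : monomial_curve M d i j (M *m mono_pt (expo d i j) d 1 t).
    rewrite monomial_curveE //; eexists; last by [].
    by apply: (mono_mono_pt aP); apply/eqP => -[/eqP]; rewrite oner_eq0.
  rewrite frob_mul trmx_mul !mulmxA -[_ *m A *m _]mulmxA -[_ *m _ *m (A *m _)]mulmxA.
  rewrite [M^T *m _]mulmxA -/B => /matrixP/(_ 0 0); rewrite !mxE => e.
  rewrite -[RHS]e horner_sum -(pair_bigA _ (fun l m => (B l m *: 'X^(w (l, m))).[t])) /=.
  rewrite exchange_big; apply: eq_bigr => m' _; rewrite !mxE mulr_suml.
  apply: eq_bigr => l' _; rewrite !mxE !hornerE !expr1n !mul1r /w /= exprD [(q * _)%N]mulnC exprM.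
  by rewrite mulrA; congr (_ * _); rewrite mulrC.
have := congr1 (fun r : {poly k} => r`_(w (l, m))) p0.
rewrite coef0 coef_sum (bigD1 (l, m)) //= big1 ?addr0 => [|[l' m'] ne].
  by rewrite coefZ coefXn eqxx mulr1.
rewrite coefZ coefXn; case: eqP => [e|_]; last by rewrite mulr0.
case: (no_collision l' m'); split=> //.
by move=> [/val_inj el /val_inj em]; rewrite el em eqxx in ne.
Qed.

(** Otherwise the whole row of the invertible matrix [B] would vanish. *)
Lemma hermitian_row_collision l : (l < 4)%N ->
  exists m l' m', (m < 4)%N /\ collision [:: 0; i; j; d]%N q l m l' m'.
Proof.
move=> hl; apply: contrapT => no.
have rowB : row (Ordinal hl) B = 0.
  apply/rowP => m; rewrite mxE [RHS]mxE; apply: hermitian_form_coef => l' m' c; apply: no.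
  by exists m, l', m'; split.
have : delta_mx 0 (Ordinal hl) = 0 :> 'rV[k]_4.
  by rewrite -(mulmxK B_unit (delta_mx _ _)) -rowE rowB mul0mx.
by move=> /rowP/(_ (Ordinal hl)); rewrite !mxE !eqxx => /eqP; rewrite oner_eq0.
Qed.

Lemma hermitian_column_collision m : (m < 4)%N ->
  exists l l' m', (l < 4)%N /\ collision [:: 0; i; j; d]%N q l m l' m'.
Proof.
move=> hm; apply: contrapT => no.
have colB : col (Ordinal hm) B = 0.
  apply/colP => l; rewrite mxE [RHS]mxE; apply: hermitian_form_coef => l' m' c; apply: no.
  by exists l, l', m'; split.
have : delta_mx (Ordinal hm) 0 = 0 :> 'cV[k]_4.
  by rewrite -(mulKmx B_unit (delta_mx _ _)) -colE colB mulmx0.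
by move=> /colP/(_ (Ordinal hm)); rewrite !mxE !eqxx => /eqP; rewrite oner_eq0.
Qed.

End HermitianSurface.

(** * The two families *)

Definition idx0 : 'I_4 := ord0.
Definition idx1 : 'I_4 := Ordinal (isT : 1 < 4)%N.
Definition idx2 : 'I_4 := Ordinal (isT : 2 < 4)%N.
Definition idx3 : 'I_4 := ord_max.

Section EndTangents.
Variable k : closedFieldType.

(** When some exponent is 1, the tangent space at the end point is a coordinate subspace, and
    diagonal matrices preserve it. *)
Lemma tangent_end_diag a D o c l (r : 'rV[k]_4) v : mono_exponents a D ->
  a o = 0%N -> (forall l, l != o -> (0 < a l)%N) -> c != o -> a c = 1%N ->
  (forall l, l != o -> l != c -> (1 < a l)%N) -> l = o ->
  tangent (mono a D) (delta_mx l 0 : 'cV[k]_4) v ->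
  tangent (mono a D) (delta_mx l 0) (diag_mx r *m v).
Proof.
move=> aP ao a_gt0 co ac a_gt1 ->; rewrite !(tangent_mono_end aP ao a_gt0 _ co ac a_gt1).
by move=> v0 l' lo lc; rewrite mul_diag_mx mxE v0 // mulr0.
Qed.

Lemma smooth_mono_interior a D (u c : k) : mono_exponents a D -> u != 0 -> c != 0 ->
  smooth_point (mono a D) (const_mx 1 : 'cV[k]_4) ->
  smooth_point (mono a D) (c *: (torus a u *m const_mx 1)).
Proof.
by move=> aP u0 c0 s1; rewrite smooth_mono_scale // (smooth_mono_torus aP).
Qed.

End EndTangents.

(** * The curves of degree q (q + 1)/g *)

Section Family.
Variables (k : closedFieldType) (q d i j : nat).
Hypotheses (q_gt1 : (1 < q)%N) (q0 : q%:R = 0 :> k).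
Local Notation g := (odd q).+1.
Hypotheses (gd : (g * d = q * q.+1)%N) (gi : (g * i = q.+1)%N) (gj : (g * j = (q ^ 2).+1)%N).

Local Notation a := (expo d i j).
Local Notation X := (mono a d : set 'cV[k]_4).

Let d_gt0 : (0 < d)%N.
Proof. by have [_ _ _] := family_arith q_gt1 gd gi gj; apply: leq_trans. Qed.

Let aP : mono_exponents a d.
Proof.
have [_ _ ij jd] := family_arith q_gt1 gd gi gj.
by apply: expo_mono_exponents => //; [exact: ltnW (ltn_trans ij jd)|exact: ltnW].
Qed.

Let a_gt0 l : l != idx0 -> (0 < a l)%N.
Proof.
have [_ i_gt0 ij jd] := family_arith q_gt1 gd gi gj.
by case: l => [[|[|[|[|//]]]] hl] // _; rewrite /expo /= (ltn_trans i_gt0).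
Qed.

Let a_ltd l : l != idx3 -> (a l < d)%N.
Proof.
have [_ i_gt0 ij jd] := family_arith q_gt1 gd gi gj.
by case: l => [[|[|[|[|//]]]] hl] // _; rewrite /expo //= (ltn_trans ij).
Qed.

(** The product g i = q + 1 equals 1 in k. *)
Let ai0 : (a idx1)%:R != 0 :> k.
Proof.
have : (g * i)%:R = 1 :> k by rewrite gi -natr1 q0 add0r.
by rewrite natrM /expo /=; apply: contra_eq_neq => ->; rewrite mulr0 eq_sym oner_eq0.
Qed.

Lemma family_smooth_one : smooth_point X (const_mx 1).
Proof.
have [di _ _ _] := family_arith q_gt1 gd gi gj; have [b jb] := family_middle q_gt1 gd gi gj.
by apply: (@smooth_mono_one _ _ _ aP idx0 idx1 idx2 idx3 q b i).
Qed.

(** The least positive exponent i divides d = q i but not j. *)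
Lemma family_not_smooth_start : ~ smooth_point X (delta_mx idx0 0).
Proof.
have [di i_gt0 ij jd] := family_arith q_gt1 gd gi gj.
apply: (@not_smooth_mono_end _ _ _ aP idx0 erefl a_gt0 idx1 idx3 idx2) => //.
- by rewrite /expo /= (ltn_trans ij).
- by rewrite /expo /= di dvdn_mull.
- by rewrite /expo /= (family_not_dvd_start q_gt1 gd gi gj).
Qed.

Let rP : mono_exponents (fun l => d - a l)%N d.
Proof.
split=> //; first by move=> l; exact: leq_subr.
  by exists idx3; exact: subnn.
by exists idx0; exact: subn0.
Qed.

Let r_gt0 l : l != idx3 -> (0 < d - a l)%N.
Proof. by rewrite subn_gt0; exact: a_ltd. Qed.

Let X_rev : X = mono (fun l => d - a l)%N d.
Proof. by apply: mono_rev; have [] := aP. Qed.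

(** Seen from the other end the exponents are d - j, d - i and d; the first divides the second, with
    quotient q + 1, but not the third. *)
Lemma family_not_smooth_end : (3 < q)%N -> ~ smooth_point X (delta_mx idx3 0).
Proof.
move=> q_gt3; rewrite X_rev.
have [di i_gt0 ij jd] := family_arith q_gt1 gd gi gj.
have [e1 e2 e3] := family_end_arith q_gt1 gd gi gj.
apply: (@not_smooth_mono_end _ _ _ rP idx3 (subnn d) r_gt0 idx2 idx1 idx0) => //; rewrite /expo /=.
- by rewrite ltn_sub2l // (ltn_trans ij).
- by rewrite subn0 ltn_subrL (leq_ltn_trans _ ij) // (leq_trans _ jd).
- by rewrite e3 dvdn_mull.
- by rewrite subn0 (family_not_dvd_end q_gt1 gd gi gj).
Qed.

Let small_end l : (q <= 3)%N -> l != idx3 -> l != idx2 -> (1 < d - a l)%N.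
Proof.
move=> q_le3; have [_ id1 d1] := family_small_end q_gt1 gd gi gj q_le3.
by case: l => [[|[|[|[|//]]]] hl] //; rewrite /expo /= ?subn0.
Qed.

Lemma family_smooth_end : (q <= 3)%N -> smooth_point X (delta_mx idx3 0).
Proof.
move=> q_le3; rewrite X_rev.
have [e _ _] := family_small_end q_gt1 gd gi gj q_le3.
apply: (@smooth_mono_end _ _ _ rP idx3 (subnn d) r_gt0 idx2) => // l.
exact: small_end.
Qed.

Lemma family_not_reflexive : ~ reflexive_variety X.
Proof.
have [di _ _ _] := family_arith q_gt1 gd gi gj; have [b jb] := family_middle q_gt1 gd gi gj.
apply: (@mono_not_reflexive _ _ _ aP idx0 idx1 idx2 idx3 idx3 q b i) => //; first exact: ltnW.
(* The condition is vacuous at the singular start; at the other end smoothness forces q <= 3, and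
   then the tangent space is a coordinate subspace. *)
move=> l s t v; rewrite !inE => /orP[]/eqP-> sl; first by case: (family_not_smooth_start sl).
have q_le3 : (q <= 3)%N by rewrite leqNgt; apply/negP => /family_not_smooth_end.
have [e _ _] := family_small_end q_gt1 gd gi gj q_le3.
rewrite X_rev /pair_scaling.
apply: (@tangent_end_diag _ _ _ idx3 idx2 _ _ _ rP (subnn d) r_gt0) => // l'.
exact: small_end.
Qed.

Lemma family_singular_locus : singular_locus X =
  if (3 < q)%N then proj_point (delta_mx idx0 0) `|` proj_point (delta_mx idx3 0)
  else proj_point (delta_mx idx0 0).
Proof.
have e0 (l : 'I_4) : delta_mx l 0 != 0 :> 'cV[k]_4.
  by apply/eqP => /colP/(_ l); rewrite !mxE !eqxx => /eqP; rewrite oner_eq0.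
have sing l (x : 'cV[k]_4) : X (delta_mx l 0) -> ~ smooth_point X (delta_mx l 0) ->
    proj_point (delta_mx l 0) x -> singular_locus X x.
  move=> Xl nl [x0 [c ex]]; have c0 : c != 0 by apply: contraNneq x0 => c0; rewrite ex c0 scale0r.
  by rewrite ex; split; [exact: mono_scale | rewrite smooth_mono_scale //].
have X0 : X (delta_mx idx0 0) by exact: mono_end.
have X3 : X (delta_mx idx3 0) by rewrite X_rev; apply: mono_end => //; exact: subnn.
have pt c l : c != 0 -> proj_point (delta_mx l 0 : 'cV[k]_4) (c *: delta_mx l 0).
  by move=> c0; split; [rewrite scaler_eq0 negb_or c0 e0 | exists c].
apply/seteqP; split=> x; last first.
  case: ifP => q_gt3 => [[px|px]|px]; move: px; apply: sing => //.
  - exact: family_not_smooth_start.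
  - exact: family_not_smooth_end.
  - exact: family_not_smooth_start.
move=> [Xx nx]; have [c c0 [ex|ex|[u u0 ex]]] := mono_cases aP a_gt0 a_ltd Xx.
- by rewrite ex; case: ifP => _; [left|]; exact: pt.
- rewrite ex; case: ifP => [_|/negbT]; first by right; exact: pt.
  rewrite -leqNgt => /family_smooth_end s3; case: nx.
  by rewrite ex smooth_mono_scale //.
- by case: nx; rewrite ex; apply: smooth_mono_interior => //; exact: family_smooth_one.
Qed.

End Family.

(** * The curve of degree q + 1 *)

Section FirstCurve.
Variables (k : closedFieldType) (q : nat).
Hypotheses (q_gt1 : (1 < q)%N) (q0 : q%:R = 0 :> k).
Local Notation a := (expo q.+1 1 q).
Local Notation X := (mono a q.+1 : set 'cV[k]_4).

Let aP : mono_exponents a q.+1.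
Proof. by apply: expo_mono_exponents => //; exact: leqW. Qed.

Let a_gt0 l : l != idx0 -> (0 < a l)%N.
Proof. by case: l => [[|[|[|[|//]]]] hl] // _; rewrite /expo /= ltnW. Qed.

Let a_lt l : l != idx3 -> (a l < q.+1)%N.
Proof. by case: l => [[|[|[|[|//]]]] hl] // _; rewrite /expo /= ltnS ltnW. Qed.

Let rP : mono_exponents (fun l => q.+1 - a l)%N q.+1.
Proof.
split=> //; first by move=> l; exact: leq_subr.
  by exists idx3; exact: subnn.
by exists idx0; exact: subn0.
Qed.

Let r_gt0 l : l != idx3 -> (0 < q.+1 - a l)%N.
Proof. by rewrite subn_gt0; exact: a_lt. Qed.

Let X_rev : X = mono (fun l => q.+1 - a l)%N q.+1.
Proof. by apply: mono_rev; have [] := aP. Qed.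

Let a_gt1 l : l != idx0 -> l != idx1 -> (1 < a l)%N.
Proof. by case: l => [[|[|[|[|//]]]] hl] // _ _; rewrite /expo /= ltnS ltnW. Qed.

Let r_gt1 l : l != idx3 -> l != idx2 -> (1 < q.+1 - a l)%N.
Proof.
case: l => [[|[|[|[|//]]]] hl] // _ _.
all: by rewrite /expo /= ?subn0 ?subSS ?subn0 // ltnS ltnW.
Qed.

Let r1 : (q.+1 - a idx2 = 1)%N. Proof. exact: subSnn. Qed.

Lemma first_smooth_one : smooth_point X (const_mx 1).
Proof.
(* The last two coordinates exchange roles: the exponents pair off as 0 with q and 1 with q + 1, so
   that b = c = 1. *)
apply: (@smooth_mono_one _ _ _ aP idx0 idx1 idx3 idx2 q 1 1) => //;
  rewrite /expo /= ?muln1 ?add1n //.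
exact: oner_neq0.
Qed.

Lemma first_nonsingular : nonsingular X.
Proof.
move=> x Xx; have [c c0 [ex|ex|[u u0 ex]]] := mono_cases aP a_gt0 a_lt Xx; rewrite ex.
- by rewrite smooth_mono_scale //; apply: (@smooth_mono_end _ _ _ aP idx0 erefl a_gt0 idx1).
- rewrite smooth_mono_scale //; rewrite X_rev.
  by apply: (@smooth_mono_end _ _ _ rP idx3 (subnn _) r_gt0 idx2).
- by apply: smooth_mono_interior => //; exact: first_smooth_one.
Qed.

Lemma first_not_reflexive : ~ reflexive_variety X.
Proof.
apply: (@mono_not_reflexive _ _ _ aP idx0 idx1 idx3 idx2 idx3 q 1 1) => //;
  rewrite /expo /= ?muln1 ?add1n //.
- exact: ltnW.
- exact: oner_neq0.
- exact: oner_neq0.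
move=> l s t v; rewrite !inE => /orP[]/eqP-> _.
  by rewrite /pair_scaling; apply: (@tangent_end_diag _ _ _ idx0 idx1 _ _ _ aP erefl a_gt0).
by rewrite X_rev /pair_scaling; apply: (@tangent_end_diag _ _ _ idx3 idx2 _ _ _ rP (subnn _) r_gt0).
Qed.

End FirstCurve.

(** * Classification of the curves up to projective isomorphism *)

Section Classification.
Variables (k : closedFieldType) (q : nat) (A : 'M[k]_4) (d : nat).
Hypotheses (q_gt1 : (1 < q)%N) (pchar_q : [pchar k].-nat q) (uA : A \in unitmx).
Hypothesis not_2_4 : ~ (q = 2%N /\ d = 4%N).
Local Notation g := (odd q).+1.

Lemma curves_T_classification C : curves_T q A d C ->
  (d = q.+1 /\ proj_isomorphic C (mono (expo q.+1 1 q) q.+1)) \/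
  exists i j, [/\ (g * d = q * q.+1)%N, (g * i = q.+1)%N, (g * j = (q ^ 2).+1)%N &
    proj_isomorphic C (mono (expo d i j) d)].
Proof.
move=> [_ sub [i [j [[/andP[i_gt0 id] /andP[j_gt0 jd] ij gcd1] [F uF eC]]]]].
(* Exchanging the two middle coordinates allows the exponents to be taken in increasing order. *)
have {i j F i_gt0 id j_gt0 jd ij gcd1 uF eC} [i [j [N [uN eC [i_gt0 ij jd gcd1]]]]] :
  exists i j (N : 'M[k]_4), [/\ N \in unitmx, C = monomial_curve N d i j &
    [/\ 0 < i, i < j, j < d & gcdn d (gcdn i j) = 1]%N].
  have [lt_ij|lt_ji|//] := ltngtP i j; first by exists i, j, F.
  have [N uN e] := monomial_curve_swap d i j uF.
  exists j, i, N; split; rewrite ?eC //.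
  by split=> //; rewrite [gcdn j i]gcdnC.
have d_gt0 : (0 < d)%N by apply: leq_trans jd.
have id : (i <= d)%N by apply: ltnW; apply: ltn_trans jd.
have iso : proj_isomorphic C (mono (expo d i j) d).
  by exists N; rewrite // eC monomial_curveE.
rewrite eC in sub.
have q_gt0 := ltnW q_gt1.
have [||[ed ei ej]|[_ [-> gd gi gj]]|[_ [-> gd gi gj]]] :=
  exponents_classification q_gt1 (introT andP (conj i_gt0 ij)) jd gcd1 not_2_4.
- by move=> l; apply: (hermitian_row_collision q_gt0 pchar_q uA uN d_gt0 id (ltnW jd) sub).
- by move=> m; apply: (hermitian_column_collision q_gt0 pchar_q uA uN d_gt0 id (ltnW jd) sub).
- by left; split=> //; move: iso; rewrite ed ei ej.
- by right; exists i, j.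
(* Exchanging s and t reduces the last outcome to the preceding one; the middle coordinates are then
   swapped to restore the order. *)
right; exists (d - j)%N, (d - i)%N.
have q_sqr : (q * q.+1 = q ^ 2 + q)%N by rewrite mulnS addnC mulnn.
have q_le : (q <= q ^ 2)%N by rewrite -mulnn leq_pmulr.
split=> //; first by rewrite mulnBr gd gj q_sqr; lia.
  by rewrite mulnBr gd gi q_sqr; lia.
have [N' uN' e'] := monomial_curve_rev uN id (ltnW jd).
have [N'' uN'' e''] := monomial_curve_swap d (d - i) (d - j) uN'.
by exists N''; rewrite // eC e' e'' monomial_curveE.
Qed.

End Classification.

(* Two exceptions of the printed theorem are taken out:
   - for q = 2 the quartic C_I(4,1,3) lies on the smooth Hermitian surface
     x1 x3^2 + x4 x2^2 + x2^3 + x3 x1^2 + x2 x4^2 + x3^3 = 0, so that T_4 can be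
     nonempty; this is the hypothesis not_2_4;
   - for q = 2 and q = 3 the curves of T_6 are smooth at the image of
     (0,0,0,1), near which (0,0,0,1) + (s^6, s^3, s, 0), respectively
     (0,0,0,1) + (s^6, s^4, s, 0), is a parametrisation of C_I; this is the
     conditional on 3 < q. *)
Theorem theorem1p1
  (p e q : nat) (p_prime : prime p) (e_gt0 : (0 < e)%N) (q_def : q = (p ^ e)%N)
  (Fq2 : finFieldType) (card_Fq2 : #|Fq2| = (q ^ 2)%N)
  (k : closedFieldType) (iota : {rmorphism Fq2 -> k})
  (k_algebraic : forall x : k, algebraicOver iota x)
  (A : 'M[k]_4) (A_unit : A \in unitmx)
  (d : nat) (d_gt0 : (0 < d)%N)
  (not_2_4 : ~ (q = 2%N /\ d = 4%N))
  (T_nonempty : curves_T q A d !=set0) :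
  let e1 : set 'cV[k]_4 := proj_point (delta_mx ord0 0) in
  let e4 : set 'cV[k]_4 := proj_point (delta_mx ord_max 0) in
  let has_singular_points (C C0 : set 'cV[k]_4) :=
    forall M : 'M[k]_4, M \in unitmx -> C = proj_image M C0 ->
      singular_locus C
      = proj_image M (if (3 < q)%N then e1 `|` e4 else e1) in
  let C1 := monomial_curve (1%:M : 'M[k]_4) q.+1 1 q in
  let C2 := monomial_curve (1%:M : 'M[k]_4) (q * q.+1) q.+1 (q ^ 2).+1 in
  let C3 := monomial_curve (1%:M : 'M[k]_4)
              ((q * q.+1) %/ 2) (q.+1 %/ 2) ((q ^ 2).+1 %/ 2) in
  [\/ d = q.+1 /\
      (forall C, curves_T q A d C ->
         [/\ proj_isomorphic C C1, nonsingular C & ~ reflexive_variety C]),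
      [/\ ~~ odd q, d = (q * q.+1)%N &
       forall C, curves_T q A d C ->
         [/\ proj_isomorphic C C2, has_singular_points C C2 & ~ reflexive_variety C]]
    | [/\ odd q, d = ((q * q.+1) %/ 2)%N &
       forall C, curves_T q A d C ->
         [/\ proj_isomorphic C C3, has_singular_points C C3 & ~ reflexive_variety C]]].
Proof.
move=> e1 e4 has_singular_points C1 C2 C3.
have q_gt1 : (1 < q)%N by rewrite q_def -(exp1n e) ltn_exp2r // prime_gt1.
have p_char : p \in [pchar k].
  apply: (rmorph_pchar iota); apply: (@card_finPcharP _ p (e * 2)) => //.
  by rewrite card_Fq2 q_def expnM.
have pchar_q : [pchar k].-nat q by rewrite q_def pnatX pnatE // p_char.
have q0 : q%:R = 0 :> k by rewrite q_def natrX (pcharf0 p_char) expr0n gtn_eqF.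
have classify C := @curves_T_classification k q A d q_gt1 pchar_q A_unit not_2_4 C.
(* Both equalities together would give q = 1 for q even and q = 2 for q odd. *)
have two_families : d = q.+1 -> ((odd q).+1 * d)%N <> (q * q.+1)%N.
  move=> -> /eqP; rewrite eqn_pmul2r // => /eqP eq_q.
  by move: q_gt1 (eq_q); rewrite -eq_q; case: (odd q).
have [C0 T0] := T_nonempty.
have [[ed _]|[i [j [gd gi gj _]]]] := classify C0 T0.
  apply: Or31; split=> // C /classify[[_ isoC]|[i [j [gd _ _ _]]]]; last first.
    by case: (two_families ed).
  rewrite /C1 monomial_curve1; split=> //.
    by have [M uM ->] := isoC; apply: nonsingular_image => //; exact: first_nonsingular.
  by move=> /(proj_isomorphic_reflexive isoC); exact: first_not_reflexive.
have family C : curves_T q A d C ->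
    [/\ proj_isomorphic C (mono (expo d i j) d),
        has_singular_points C (mono (expo d i j) d) & ~ reflexive_variety C].
  have cancel_g x y : ((odd q).+1 * x = (odd q).+1 * y)%N -> x = y.
    by move=> /eqP; rewrite eqn_pmul2l // => /eqP.
  move=> /classify[[ed _]|[i' [j' [_ gi' gj' isoC]]]]; first by case: (two_families ed).
  have ei : i' = i by apply: cancel_g; rewrite gi gi'.
  have ej : j' = j by apply: cancel_g; rewrite gj gj'.
  rewrite ei ej in isoC; split=> //.
    move=> M uM ->; rewrite singular_locus_image //.
    by rewrite (family_singular_locus q_gt1 q0 gd gi gj).
  by move=> /(proj_isomorphic_reflexive isoC); exact: (family_not_reflexive q_gt1 q0 gd gi gj).
case: (boolP (odd q)) => odd_q; rewrite ?odd_q ?(negbTE odd_q) ?mul1n in gd gi gj.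
  have ed : d = ((q * q.+1) %/ 2)%N by rewrite -gd mulKn.
  apply: Or33; split=> // C /family; rewrite /C3 monomial_curve1.
  by rewrite -ed -gi -gj !mulKn.
by apply: Or32; split=> // C /family; rewrite /C2 monomial_curve1 -gd -gi -gj.
Qed.
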